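(* Let $G$ be a compact group in which every subgroup (closed or not) is measurable. Then $G$ is a strongly complete group; that is, $G$ is profinite and every subgroup of finite index in $G$ is open.
   Context: Compact groups are compact Hausdorff topological groups. For a compact group $G$, ''measurable'' means measurable with respect to the unique normalized Haar measure $\mu$ on $G$. Every Borel subset of $G$ is measurable. A subset $S\subseteq G$ is a null set if $\mu(K)=0$ for each compact $K\subseteq S$ and for each $\epsilon>0$ there is an open set $U\supseteq S$ with $\mu(U)<\epsilon$; every subset of a null set is measurable (i.e. Haar measure is taken to be complete). A strongly complete group is a profinite group in which every subgroup of finite index is open. *)

(* Defs.v *)
From HB Require Import structures.
From mathcomp Require Import all_boot all_order all_algebra fingroup.
From mathcomp Require Import all_classical all_reals all_analysis.

Set Implicit Arguments.
Unset Strict Implicit.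
Unset Printing Implicit Defensive.

Import Order.TTheory GRing.Theory Num.Theory.

Local Open Scope classical_set_scope.

HB.mixin Record isTopologicalGroup G & Topological G & monoid.Group G := {
  mulg_continuous : continuous (fun x : G * G => (x.1 * x.2)%g) ;
  invg_continuous : continuous (fun x : G => x^-1%g)
}.

#[short(type="topologicalGroupType")]
HB.structure Definition TopologicalGroup :=
  {G of Topological G & monoid.Group G & isTopologicalGroup G}.

Definition compact_group (G : topologicalGroupType) : Prop :=
  compact [set: G] /\ hausdorff_space G.

(* [g_sigma_algebraType] expects a pointed type; this alias points a group at
   its identity. *)
Definition pointed_group (G : groupType) : Type := G.

HB.instance Definition _ (G : groupType) := Choice.on (pointed_group G).
HB.instance Definition _ (G : groupType) :=
  isPointed.Build (pointed_group G) (1%g : G).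

Notation borelType G :=
  (g_sigma_algebraType (@open G : set (set (pointed_group G)))).

Section Haar.
Context {R : realType} {G : topologicalGroupType}.
Implicit Types (mu : probability (borelType G) R) (A S N K U : set G).
Local Open Scope ereal_scope.

Record is_haar mu : Prop := IsHaar {
  haar_left_invariant : forall (g : G) A, <<s @open G >> A ->
    mu [set (g * x)%g | x in A] = mu A ;
  haar_outer_regular : forall A, <<s @open G >> A ->
    mu A = ereal_inf [set mu U | U in [set U | open U /\ A `<=` U]] ;
  haar_inner_regular : forall A, <<s @open G >> A ->
    mu A = ereal_sup [set mu K | K in [set K | compact K /\ K `<=` A]]
}.

Definition haar_null mu S : Prop :=
  (forall K, compact K -> K `<=` S -> mu K = 0) /\
  (forall e : R, (0 < e)%R ->
     exists U, [/\ open U, S `<=` U & mu U < e%:E]).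

(* As [completed_algebra_gen], with [haar_null] in place of the library's
   negligible sets. *)
Definition haar_measurable mu : set (set G) :=
  [set B `|` N | B in <<s @open G >> & N in haar_null mu].

End Haar.

Definition subgroup (G : groupType) (H : set G) : Prop :=
  group_closed (fun x : G => x \in H).

Definition finite_index (G : groupType) (H : set G) : Prop :=
  finite_set [set [set (g * h)%g | h in H] | g in [set: G]].

(* [isys_map i j] is meaningful only when [isys_le i j]; elsewhere it is an
   arbitrary function. *)
Record inverse_system := InverseSystem {
  isys_index : Type ;
  isys_le : isys_index -> isys_index -> Prop ;
  isys_inhabited : inhabited isys_index ;
  isys_le_refl : forall i, isys_le i i ;
  isys_le_trans : forall i j k, isys_le i j -> isys_le j k -> isys_le i k ;
  isys_directed : forall i j, exists2 k, isys_le i k & isys_le j k ;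
  isys_group : isys_index -> finGroupType ;
  isys_map : forall i j, isys_group j -> isys_group i ;
  isys_mapM : forall i j, isys_le i j ->
    {morph @isys_map i j : x y / (x * y)%g} ;
  isys_map_id : forall i, @isys_map i i =1 id ;
  isys_map_comp : forall i j k, isys_le i j -> isys_le j k ->
    @isys_map i j \o @isys_map j k =1 @isys_map i k
}.

Definition isys_prod (S : inverse_system) : topologicalType :=
  prod_topology (fun i : isys_index S => discrete_topology (isys_group i)).

Definition inverse_limit (S : inverse_system) : set (isys_prod S) :=
  [set x | forall i j : isys_index S, isys_le i j -> isys_map i (x j) = x i].

Arguments inverse_limit : clear implicits.

(* An isomorphism of topological groups from G onto the inverse limit, seen as
   an injection p into the product: the topology of G is the one pulled back
   along p, that is, p is a homeomorphism onto its image. *)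
Definition profinite (G : topologicalGroupType) : Prop :=
  exists (S : inverse_system) (p : G -> isys_prod S),
    [/\ forall i : isys_index S, {morph (fun x => p x i) : x y / (x * y)%g},
        injective p,
        range p = inverse_limit S
      & @open G = [set p @^-1` V | V in @open (isys_prod S)] ].

Definition strongly_complete (G : topologicalGroupType) : Prop :=
  profinite G /\
  forall H : set G, subgroup H -> finite_index H -> open H.

(* Main.v *)
Require Import Defs.
From HB Require Import structures.
From mathcomp Require Import all_boot all_order all_algebra all_fingroup.
From mathcomp Require Import all_classical all_reals all_analysis.
From mathcomp Require Import measurable_realfun ring lra.

(* A measurable subgroup of positive measure is open, by Steinhaus' argument.
   Hence, if G is covered by countably many cosets of measurable subgroups, one
   of these subgroups is open; this settles the subgroups of finite index.

   To see that G is profinite, we separate g <> 1 from 1 by a clopen set.  By the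
   Peter-Weyl theorem there is a continuous orthogonal matrix representation rho
   with rho g <> 1.  The field R is the union of an increasing sequence of proper
   subfields K m, relatively algebraically closed in R (take away from a
   transcendence basis all but the first m terms of a countable subset).  The
   elements x of G such that rho x has all its entries in K m form a subgroup H m,
   and G is the union of the H m, so some H m is open.  On H m each matrix entry
   takes values in K m, which contains no interval, so that an entry which differs
   at 1 and g can be cut at a number outside K m.

   The Peter-Weyl theorem is proved inside the continuous functions: a maximizing
   sequence for the L^2 norm of a convolution operator T converges uniformly along
   an ultrafilter, after applying T twice, to an eigenfunction of T^2, and the
   eigenspaces of T^2 for nonzero eigenvalues are finite-dimensional and invariant
   under translations. *)

Set Implicit Arguments.
Unset Strict Implicit.
Unset Printing Implicit Defensive.
Import Order.TTheory GRing.Theory Num.Theory.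
Import numFieldNormedType.Exports.
Local Open Scope classical_set_scope.
Local Open Scope ring_scope.

(** * Chains of relatively algebraically closed subfields *)

Section Subfield.
Variables (F : fieldType) (S : {pred F}) (divS : divring_closed S).

(** The set [S] is turned into a field type of its own so that the theory of integral elements
    applies to the inclusion [FtoE]. Through [algebraic_overP], closure of algebraic elements under
    ring operations and roots comes from that theory. *)
Record subfield := Subfield { subfield_val :> F; subfield_valP : subfield_val \in S }.

HB.instance Definition _ := GRing.isDivringClosed.Build F S divS.
HB.instance Definition _ := [isSub for subfield_val].
HB.instance Definition _ := [Choice of subfield by <:].
HB.instance Definition _ := [SubChoice_isSubComUnitRing of subfield by <:].
HB.instance Definition _ := [SubComUnitRing_isSubIntegralDomain of subfield by <:].
HB.instance Definition _ := [SubIntegralDomain_isSubField of subfield by <:].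

Let FtoE : {rmorphism subfield -> F} := \val.

Definition algebraic_over x :=
  exists p : {poly F}, [/\ p != 0, forall i, p`_i \in S & root p x].

Lemma algebraic_overP x : algebraic_over x <-> integralOver FtoE x.
Proof.
split=> [[p [p0 Sp px]]|/integral_algebraic[p p0 px]].
  apply/integral_algebraic.
  exists (\poly_(i < size p) Subfield (Sp i)); last first.
    congr (root _ _): px; apply/polyP => i.
    rewrite coef_map coef_poly; case: ltnP => //= ip.
    by rewrite nth_default.
  apply: contraNneq p0 => /polyP p0; apply/eqP/polyP => i.
  have := p0 i; rewrite coef_poly coef0 coef0; case: ltnP => [ip /(congr1 \val)//|ip _].
  by rewrite nth_default.
exists (map_poly FtoE p); split; rewrite ?map_poly_eq0 //.
by move=> i; rewrite coef_map; exact: valP.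
Qed.

Lemma algebraic_over_root (p : {poly F}) x : p != 0 ->
  (forall i, algebraic_over p`_i) -> root p x -> algebraic_over x.
Proof.
move=> p0 Sp px; apply/algebraic_overP; apply: (integral_root p0 px).
by apply/integral_poly => i; apply/algebraic_overP.
Qed.

End Subfield.

Section RelativelyClosed.
Variable F : fieldType.
Implicit Types (K A : set F) (p : {poly F}).

(** Such a [K] is a subfield: for nonzero x in [K], the inverse of x is a root of x X - 1, so
    inverses come from [rac_root]. *)
Record rel_alg_closed K : Prop := RelAlgClosed {
  rac1 : K 1 ;
  racB : forall x y, K x -> K y -> K (x - y) ;
  racM : forall x y, K x -> K y -> K (x * y) ;
  rac_root : forall p x, p != 0 -> (forall i, K p`_i) -> root p x -> K x
}.

(** This is the algebraic closure, inside [F], of the subfield generated by [A]. *)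
Definition alg_span A := \bigcap_(K in [set K | rel_alg_closed K /\ A `<=` K]) K.

Lemma rac0 K : rel_alg_closed K -> K 0.
Proof. by move=> Kc; rewrite -(subrr 1); apply: racB; do ?exact: rac1. Qed.

Lemma racD K x y : rel_alg_closed K -> K x -> K y -> K (x + y).
Proof.
move=> Kc Kx Ky; rewrite -[y]opprK -[- y]sub0r.
by apply: racB => //; apply: racB => //; exact: rac0.
Qed.

Lemma rac_sum K I r (P : pred I) (f : I -> F) : rel_alg_closed K ->
  (forall i, P i -> K (f i)) -> K (\sum_(i <- r | P i) f i).
Proof. by move=> Kc Kf; apply: big_ind => //; [exact: rac0 | move=> *; exact: racD]. Qed.

Lemma racX K x n : rel_alg_closed K -> K x -> K (x ^+ n).
Proof.
move=> Kc Kx; elim: n => [|n ih]; rewrite ?expr0 ?exprS; first exact: rac1.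
exact: racM.
Qed.

Lemma rac_horner K p x : rel_alg_closed K -> (forall i, K p`_i) -> K x -> K p.[x].
Proof.
by move=> Kc Kp Kx; rewrite horner_coef; apply: rac_sum => // i _; apply: racM => //; exact: racX.
Qed.

Lemma alg_span_rac A : rel_alg_closed (alg_span A).
Proof.
split=> [K [Kc _]|x y Ax Ay K KA|x y Ax Ay K KA|p x p0 pA px K KA].
- exact: rac1.
- by apply: (racB KA.1); [exact: Ax | exact: Ay].
- by apply: (racM KA.1); [exact: Ax | exact: Ay].
- by apply: (rac_root KA.1 p0 _ px) => i; exact: pA.
Qed.

Lemma sub_alg_span A : A `<=` alg_span A.
Proof. by move=> x Ax K [_]; apply. Qed.

Lemma alg_span_min A K : rel_alg_closed K -> A `<=` K -> alg_span A `<=` K.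
Proof. by move=> Kc AK x; apply. Qed.

Lemma alg_spanS A B : A `<=` B -> alg_span A `<=` alg_span B.
Proof.
move=> AB; apply: alg_span_min; first exact: alg_span_rac.
by apply: subset_trans AB _; exact: sub_alg_span.
Qed.

Lemma algebraic_over_rac (S : {pred F}) : divring_closed S ->
  rel_alg_closed (algebraic_over S).
Proof.
move=> divS; split=> [|x y /(algebraic_overP divS) Sx /(algebraic_overP divS) Sy
    |x y /(algebraic_overP divS) Sx /(algebraic_overP divS) Sy|p x p0 pA px].
- exact/(algebraic_overP divS)/integral1.
- exact/(algebraic_overP divS)/integral_sub.
- exact/(algebraic_overP divS)/integral_mul.
- exact: algebraic_over_root p0 pA px.
Qed.

(** Each closure condition involves finitely many elements, namely two operands or the coefficients
    of one polynomial, and in a chain these all lie in a single member. *)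
Lemma rac_bigcup I (D : set I) (f : I -> set F) : D !=set0 ->
  (forall i j, D i -> D j -> f i `<=` f j \/ f j `<=` f i) ->
  (forall i, D i -> rel_alg_closed (f i)) -> rel_alg_closed (\bigcup_(i in D) f i).
Proof.
move=> [i0 Di0] tot fc.
have two x y : (\bigcup_(i in D) f i) x -> (\bigcup_(i in D) f i) y ->
    exists2 i, D i & f i x /\ f i y.
  move=> [i Di fx] [j Dj fy]; case: (tot i j Di Dj) => ij.
    by exists j => //; split => //; exact: ij.
  by exists i => //; split => //; exact: ij.
split=> [|x y fx fy|x y fx fy|p x p0 pf px].
- by exists i0 => //; exact: (rac1 (fc _ Di0)).
- by have [i Di [ix iy]] := two _ _ fx fy; exists i => //; exact: (racB (fc _ Di)).
- by have [i Di [ix iy]] := two _ _ fx fy; exists i => //; exact: (racM (fc _ Di)).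
have [i Di fi] : exists2 i, D i & forall k, (k < size p)%N -> f i p`_k.
  elim: (size p) => [|n [i Di ih]]; first by exists i0.
  have [j Dj fj] := pf n; case: (tot i j Di Dj) => ij.
    exists j => // k; rewrite ltnS leq_eqVlt => /orP[/eqP-> //|/ih]; exact: ij.
  exists i => // k; rewrite ltnS leq_eqVlt => /orP[/eqP->|/ih//]; exact: ij.
exists i => //; apply: (rac_root (fc _ Di) p0 _ px) => k.
by have [/fi//|/(nth_default 0)->] := ltnP k (size p); exact: (rac0 (fc _ Di)).
Qed.

(** * Exchange property of algebraic dependence *)

Section Exchange.
Variables (K : set F) (Kc : rel_alg_closed K) (x : F).

Let KP p := forall i, K p`_i.

Let KPB p q : KP p -> KP q -> KP (p - q).
Proof. by move=> Kp Kq i; rewrite coefB; exact: racB. Qed.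

Let KPM p q : KP p -> KP q -> KP (p * q).
Proof. by move=> Kp Kq i; rewrite coefM; apply: rac_sum => // j _; exact: racM. Qed.

Let KPC c : K c -> KP c%:P.
Proof. by move=> Kc' i; rewrite coefC; case: ifP => // _; exact: rac0. Qed.

Let KPX : KP 'X.
Proof. by move=> i; rewrite coefX; case: eqP => _; [exact: rac1 | exact: rac0]. Qed.

(** The field K(x). Only the value of the denominator at [x] must be nonzero, so [x] may also be
    algebraic over [K]. *)
Definition fraction_field : {pred F} :=
  [pred u | `[< exists p q, [/\ KP p, KP q, q.[x] != 0 & u = p.[x] / q.[x]] >]].

Lemma fraction_fieldP u : reflect
  (exists p q, [/\ KP p, KP q, q.[x] != 0 & u = p.[x] / q.[x]]) (u \in fraction_field).
Proof. exact: asboolP. Qed.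

Lemma fraction_field_divring : divring_closed fraction_field.
Proof.
have K1 := KPC (rac1 Kc).
split=> [|u v /fraction_fieldP[p [q [Kp Kq q0 ->]]] /fraction_fieldP[r [s [Kr Ks s0 ->]]]
  |u v /fraction_fieldP[p [q [Kp Kq q0 ->]]] /fraction_fieldP[r [s [Kr Ks s0 ->]]]].
- apply/fraction_fieldP; exists 1%:P, 1%:P; split=> //; rewrite hornerC ?oner_eq0 //.
  by rewrite divr1.
- apply/fraction_fieldP; exists (p * s - r * q), (q * s); split.
  + by apply: KPB; exact: KPM.
  + exact: KPM.
  + by rewrite hornerM mulf_neq0.
  + by rewrite hornerD hornerN !hornerM -[- (r.[x] / _)]mulNr addf_div // mulNr.
(* Division by zero yields 0, so a zero divisor requires its own representation. *)
- apply/fraction_fieldP; have [->|r0] := eqVneq r.[x] 0.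
    exists 0%:P, 1%:P; split => //; first exact: KPC (rac0 Kc).
      by rewrite hornerC oner_eq0.
    by rewrite mul0r invr0 mulr0 hornerC mul0r.
  exists (p * s), (q * r); split; try exact: KPM.
    by rewrite hornerM mulf_neq0.
  by rewrite !hornerM invf_div mulf_div.
Qed.

(** By Horner induction on [p]: each step multiplies by the denominator of the constant coefficient.
    In [P] the inner variable stands for [x] and the outer one is the variable of [p]. *)
Lemma clear_denominators (p : {poly F}) : (forall i, p`_i \in fraction_field) ->
  exists C (P : {poly {poly F}}), [/\ KP C, C.[x] != 0, forall i, KP P`_i &
    map_poly (horner_eval x) P = C.[x] *: p].
Proof.
elim/poly_ind: p => [_|p c ih pc].
  exists 1%:P, 0; split; first exact: KPC (rac1 Kc).
  - by rewrite hornerC oner_eq0.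
  - by move=> i; rewrite coef0; exact: KPC (rac0 Kc).
  - by rewrite map_poly0 scaler0.
have [|C [P [KC C0 KPP PE]]] := ih.
  by move=> i; have := pc i.+1; rewrite coefD coefMX coefC /= addr0.
have /fraction_fieldP[a [b [Ka Kb b0 cE]]] := pc 0%N.
rewrite coefD coefMX coefC /= add0r in cE.
exists (C * b), (b%:P * P * 'X + (a * C)%:P); split; first exact: KPM.
- by rewrite hornerM mulf_neq0.
- move=> i; rewrite coefD coefMX coefC coefCM; case: i => [|i] /=.
    by rewrite add0r; exact: KPM.
  by rewrite addr0; exact: KPM.
- rewrite rmorphD !rmorphM /= map_polyX !map_polyC /= /horner_eval PE !hornerM cE.
  rewrite scalerDr -!mul_polyC; congr (_ + _).
    by rewrite !mulrA -!polyCM [b.[x] * _]mulrC.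
  by rewrite -!polyCM -[in RHS]mulrA [b.[x] * _]mulrC mulfVK // mulrC.
Qed.

(* A polynomial relation P x y = 0 that makes y algebraic over K(x) also makes x
   algebraic over K(y), since y is transcendental over K. *)
Lemma exchange y : alg_span (x |` K) y -> ~ K y -> alg_span (y |` K) x.
Proof.
move=> xy Ky.
have [p [p0 pM py]] : algebraic_over fraction_field y.
  apply: alg_span_min xy; first exact/algebraic_over_rac/fraction_field_divring.
  have aM u : u \in fraction_field -> algebraic_over fraction_field u.
    move=> Mu; apply/(algebraic_overP fraction_field_divring).
    exact: (integral_id _ (Subfield Mu)).
  move=> u [->|Ku]; apply/aM/fraction_fieldP.
    exists 'X, 1%:P; split => //; first exact: KPC (rac1 Kc).
      by rewrite hornerC oner_eq0.
    by rewrite hornerX hornerC divr1.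
  exists u%:P, 1%:P; split; first exact: KPC.
    exact: KPC (rac1 Kc).
    by rewrite hornerC oner_eq0.
  by rewrite !hornerC divr1.
have [C [P [KC C0 KPP PE]]] := clear_denominators pM.
have P0 : P != 0.
  apply: contra_neq p0 => P0; move: PE; rewrite P0 map_poly0 => /esym/eqP.
  by rewrite scaler_eq0 (negbTE C0) => /eqP.
(* Swapping the variables of [P] and evaluating the inner one at [y] gives a polynomial over K[y]
   that vanishes at [x]. *)
pose Q := map_poly (horner_eval y) (swapXY P).
have Kr j i : K (swapXY P)`_j`_i by rewrite coef_swapXY; exact: KPP.
have yK : alg_span (y |` K) y by apply: sub_alg_span; left.
apply: (@rac_root _ (alg_span_rac _) Q).
(* If [Q] were zero, every coefficient of [swapXY P] would vanish at [y]; a nonzero one has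
   coefficients in [K] and would put [y] in [K]. *)
- rewrite -swapXY_eq0 in P0; apply: contraNneq P0 => Q0; apply/eqP/polyP => j.
  apply/eqP; rewrite coef0; apply: contrapT => /negP r0; apply: Ky.
  apply: (rac_root Kc r0) => // ; apply/rootP.
  by move/polyP/(_ j): Q0; rewrite coef_map coef0.
- move=> j; rewrite coef_map /=; apply: (rac_horner (alg_span_rac _)) => // i.
  by apply: sub_alg_span; right.
- rewrite /Q -horner_polyC; apply/rootP.
  by rewrite -horner2_swapXY horner_swapXY PE hornerZ (rootP py) mulr0.
Qed.

End Exchange.

Lemma root_listing p : p != 0 -> exists s : seq F, forall x, root p x -> x \in s.
Proof.
have [n] := ubnP (size p); elim: n p => // n ih p; rewrite ltnS => pn p0.
have [[a /factor_theorem[q pE]]|nop] := pselect (exists a, root p a); last first.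
  by exists [::] => x px; case: nop; exists x.
have q0 : q != 0 by apply: contraNneq p0 => q0; rewrite pE q0 mul0r.
have [|s qs] := ih q _ q0.
  by move: pn; rewrite pE size_Mmonic ?monicXsubC // size_XsubC addn2.
exists (a :: s) => x; rewrite pE rootM root_XsubC inE orbC => /orP[-> //|/qs ->].
by rewrite orbT.
Qed.

(* The nodes of a generic tree serve as syntax for 1, subtraction, multiplication
   and extraction of the k-th root of a polynomial with given coefficients. *)
Lemma countable_alg_span (b : nat -> F) : countable (alg_span (range b)).
Proof.
have [rts rtsP] : exists rts : {poly F} -> seq F,
    forall p, p != 0 -> forall x, root p x -> x \in rts p.
  have /choice[rts rtsP] p : exists s : seq F, p != 0 -> forall x, root p x -> x \in s.
    have [->|/root_listing[s]] := eqVneq p 0; first by exists [::].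
    by exists s.
  by exists rts.
pose fix ev (t : GenTree.tree nat) : F := match t with
  | GenTree.Leaf i => b i
  | GenTree.Node 0 _ => 1
  | GenTree.Node 1 ts => (map ev ts)`_0 - (map ev ts)`_1
  | GenTree.Node 2 ts => (map ev ts)`_0 * (map ev ts)`_1
  | GenTree.Node k.+3 ts => (rts (Poly (map ev ts)))`_k end.
suff sub : alg_span (range b) `<=` range ev.
  apply: sub_countable (subset_card_le sub) _.
  exact: sub_countable (card_image_le _ _) (countableP _).
apply: alg_span_min; last by move=> _ [i _ <-]; exists (GenTree.Leaf i).
split=> [|_ _ [s _ <-] [t _ <-]|_ _ [s _ <-] [t _ <-]|p x p0 pK px].
- by exists (GenTree.Node 0 [::]).
- by exists (GenTree.Node 1 [:: s; t]).
- by exists (GenTree.Node 2 [:: s; t]).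
have /choice[g gP] i : exists t, ev t = p`_i by have [t _] := pK i; exists t.
exists (GenTree.Node (index x (rts p)).+3 (mkseq g (size p))) => //=.
suff -> : map ev (mkseq g (size p)) = p by rewrite polyseqK nth_index // rtsP.
by rewrite -map_comp -[RHS](mkseq_nth 0); apply: eq_map => i /=.
Qed.

(** Greedy choice: the span of finitely many terms is countable, hence some element of [F] lies
    outside it and can serve as the next term. *)
Lemma free_sequence : ~ countable [set: F] ->
  exists b : nat -> F, forall n, ~ alg_span [set b i | i in `I_n] (b n).
Proof.
move=> nc.
have /choice[nxt nxtP] (s : seq F) : exists x, ~ alg_span [set` s] x.
  apply: contrapT => /forallNP all; apply: nc.
  apply: sub_countable (countable_alg_span (nth 0 s)); apply: subset_card_le => x _.
  have /alg_spanS : [set` s] `<=` range (nth 0 s); last by apply; exact: contrapT.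
  by move=> y /(nthP 0)[i _ <-]; exists i.
pose s := fix s n := if n is m.+1 then rcons (s m) (nxt (s m)) else [::].
exists (nxt \o s) => n; suff -> : [set (nxt \o s) i | i in `I_n] = [set` s n] by exact: nxtP.
elim: n => [|n ih]; first by rewrite II0 image_set0; apply/seteqP; split.
rewrite IIS image_setU ih image_set1; apply/seteqP; split => x /=; rewrite mem_rcons inE.
  by case=> [->|->]; rewrite ?eqxx ?orbT.
by case/orP => [/eqP ->|]; [right | left].
Qed.

(* Take a free sequence b and, by Zorn's lemma, a maximal set A over which b
   stays free; the spans of A and the first n terms of b do the job. *)
Theorem subfield_chain : ~ countable [set: F] ->
  exists K : nat -> set F, [/\ forall n, rel_alg_closed (K n),
    forall n, K n `<=` K n.+1, \bigcup_n K n = setT & forall n, K n != setT].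
Proof.
move=> /free_sequence[b bP]; pose B n := [set b i | i in `I_n].
have [A [AP Amax]] : exists A, (forall n, ~ alg_span (A `|` B n) (b n)) /\
    forall A', A `<` A' -> ~ (forall n, ~ alg_span (A' `|` B n) (b n)).
  apply: Zorn_bigcup => C CP Ctot n.
  have [C0|/set0P C0] := eqVneq C set0.
    by rewrite C0 bigcup_set0 set0U; exact: bP.
  (* The union of the spans is closed and contains the union of the chain together with [B n]. So if
     [b n] depended on the union, it would already depend on one member. *)
  have Crac : rel_alg_closed (\bigcup_(X in C) alg_span (X `|` B n)).
    apply: (rac_bigcup C0) => [X Y CX CY|X CX]; last exact: alg_span_rac.
    by case: (Ctot X Y CX CY) => XY; [left|right]; apply: alg_spanS; exact: setSU.
  move=> /(_ _ (conj Crac _))[|X CX]; last exact: CP CX n.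
  move=> x [[X CX Xx]|Bx]; first by exists X => //; apply: sub_alg_span; left.
  by have [X CX] := C0; exists X => //; apply: sub_alg_span; right.
pose K n := alg_span (A `|` B n).
have Kc n : rel_alg_closed (K n) := alg_span_rac _.
have KS n : K n `<=` K n.+1 by apply: alg_spanS; apply: setUS => _ [i /= /leqW ni <-]; exists i.
exists K; split => //; last first.
  by move=> n; apply/eqP => KT; apply: (AP n); rewrite -/(K n) KT.
rewrite -subTset => x _; apply: contrapT => nKx.
apply: (Amax (x |` A)).
  split; first exact: subsetUr.
  move=> /(_ x (or_introl erefl)) Ax; apply: nKx; exists 0%N => //.
  by apply: sub_alg_span; left.
(* If adding [x] makes [b n] dependent, exchange puts [x] in the span of [b n] and [K n], which is
   contained in [K n.+1]. *)
move=> n xbn; apply: nKx; exists n.+1 => //.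
have /(@exchange _ (Kc n)) : alg_span (x |` K n) (b n).
  apply: alg_spanS xbn => y [[->|Ay]|By]; [by left|right|right].
    by apply: sub_alg_span; left.
  by apply: sub_alg_span; right.
move=> /(_ (AP n)); apply: alg_span_min => // y [->|]; last exact: KS.
by apply: sub_alg_span; right; exists n => //=.
Qed.

End RelativelyClosed.

(** * Measurable subgroups *)

Section TopologicalGroups.
Context {G : topologicalGroupType}.
Implicit Types (g x y : G) (A H K U : set G).

Lemma cvg_mulg T (F : set_system T) (FF : Filter F) (f h : T -> G) x y :
  f @ F --> x -> h @ F --> y -> (fun t => f t * h t)%g @ F --> (x * y)%g.
Proof.
move=> fx hy; apply: (@continuous2_cvg _ _ _ _ _ _ f h (fun x y => x * y)%g) => //.
exact: (mulg_continuous (x, y)).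
Qed.

Lemma cvg_invg T (F : set_system T) (FF : Filter F) (f : T -> G) x :
  f @ F --> x -> (fun t => (f t)^-1)%g @ F --> x^-1%g.
Proof. by move=> fx; apply: cvg_comp fx _; exact: invg_continuous. Qed.

Lemma lmulg_continuous g : continuous (fun x => g * x)%g.
Proof. by move=> x; apply: cvg_mulg; [exact: cvg_cst | exact: cvg_id]. Qed.

Lemma lcosetE g A : [set (g * x)%g | x in A] = (fun x => g^-1 * x)%g @^-1` A.
Proof.
apply/seteqP; split => [_ [x Ax <-]|x Ax] /=; first by rewrite mulKg.
by exists (g^-1 * x)%g => //; exact: mulVKg.
Qed.

Lemma open_lcoset g U : open U -> open [set (g * x)%g | x in U].
Proof.
by move=> oU; rewrite lcosetE; apply: open_comp => // x _; exact: lmulg_continuous.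
Qed.

Section Subgroups.
Variables (H : set G) (sgH : subgroup H).

Lemma subgroup1 : H 1%g. Proof. by have [/set_mem] := sgH. Qed.

Lemma subgroupV x : H x -> H x^-1%g.
Proof. by move=> /mem_set Hx; apply: set_mem; exact: monoid.group_closedV. Qed.

Lemma subgroupM x y : H x -> H y -> H (x * y)%g.
Proof. by move=> /mem_set Hx /mem_set Hy; apply: set_mem; exact: monoid.group_closedM. Qed.

Lemma nbhs1_subgroup_open : nbhs 1%g H -> open H.
Proof.
move=> H1; rewrite openE => h Hh; rewrite /interior.
have : \forall x \near h, H (h^-1 * x)%g by apply: lmulg_continuous; rewrite mulVg.
apply: filterS => x /= Hx.
by rewrite -[x](mulVKg h); exact: subgroupM.
Qed.

Lemma open_subgroup_closed : open H -> closed H.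
Proof.
move=> oH; rewrite -openC openE => x nHx; rewrite /interior.
have : \forall y \near x, H (x^-1 * y)%g.
  by apply: lmulg_continuous; rewrite mulVg; apply: open_nbhs_nbhs; split => //; exact: subgroup1.
apply: filterS => y /= Hxy Hy; apply: nHx.
rewrite -[x]invgK -[(x^-1)%g](mulgK y); apply: subgroupV; apply: subgroupM => //.
exact: subgroupV.
Qed.

End Subgroups.
End TopologicalGroups.

(** * Steinhaus' argument and countable covers by cosets *)

Section Steinhaus.
Context {R : realType} {G : topologicalGroupType} (mu : probability (borelType G) R).
Hypotheses (cG : compact_group G) (muH : is_haar mu).
Implicit Types (A B H K U : set G).
Local Open Scope ereal_scope.

Lemma open_borel U : open U -> <<s @open G >> U.
Proof. exact: sub_sigma_algebra. Qed.

Lemma compact_borel K : compact K -> <<s @open G >> K.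
Proof.
move=> cK; have : closed K := compact_closed cG.2 cK.
rewrite -openC -[X in _ -> <<s _ >> X]setCK => /open_borel oK.
exact: (@measurableC _ (borelType G)).
Qed.

Lemma haarS A B : <<s @open G >> A -> <<s @open G >> B -> A `<=` B -> mu A <= mu B.
Proof. by move=> mA mB AB; apply: le_measure => //; rewrite inE. Qed.

Lemma outer_regular_lt A (r : \bar R) : <<s @open G >> A -> mu A < r ->
  exists U, [/\ open U, A `<=` U & mu U < r].
Proof.
move=> mA; rewrite (haar_outer_regular muH mA) => /ereal_inf_lt[_ [U [oU AU] <-] Ur].
by exists U.
Qed.

(* Steinhaus: if K is compact in H with mu K > 0 and U is an open neighbourhood
   of K with mu U < 2 mu K, then v K meets K for every v with v K inside U. *)
Lemma steinhaus H B : subgroup H -> B `<=` H -> <<s @open G >> B -> 0 < mu B -> open H.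
Proof.
move=> sgH BH mB; rewrite (haar_inner_regular muH mB) => /ereal_sup_gt[_ [K [cK KB] <-] K0].
have mK := compact_borel cK.
have Kfin : mu K \is a fin_num by exact: fin_num_measure.
have [|U [oU KU Uk]] := @outer_regular_lt K (mu K + mu K) mK.
  by rewrite -[X in X < _]adde0 lteD2lE.
apply: nbhs1_subgroup_open => //.
have : \forall v \near (1%g : G), K `<=` (fun k => U (v * k)%g).
  have /compact_near_coveringP/(_ _ (nbhs (1%g : G)) (fun v k => U (v * k)%g) _) := cK.
  apply => k Kk.
  have : nbhs (1 * k)%g U by rewrite mul1g; apply: open_nbhs_nbhs; split => //; exact: KU.
  have cvgm : (fun t : G * G => t.2 * t.1)%g @ (k, 1%g : G) --> (1 * k)%g.
    by apply: cvg_mulg; [exact: cvg_snd | exact: cvg_fst].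
  by move=> /cvgm.
apply: filterS => v vK.
have [[k Kk Kvk]|KvK] := pselect (exists2 k, K k & K (v * k)%g).
  rewrite -[v](mulgK k); apply: subgroupM => //; first exact/BH/KB.
  by apply: subgroupV => //; exact/BH/KB.
have mvK : <<s @open G >> [set (v * k)%g | k in K].
  apply: compact_borel; apply: continuous_compact => //.
  by apply: continuous_subspaceT; exact: lmulg_continuous.
suff : mu K + mu K <= mu U by rewrite leNgt Uk.
rewrite -{1}(haar_left_invariant muH v mK) -measureU //; last first.
  by apply/seteqP; split => // _ [[k Kk <-] Kvk]; apply: KvK; exists k.
apply: haarS => //; last by move=> x [[k Kk <-]|/KU //]; exact: vK.
  exact: (@measurableU _ (borelType G)).
exact: open_borel.
Qed.

(** The Borel part of [H] has measure zero, since otherwise [steinhaus] would make [H] open; outer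
    regularity covers it by a small open set, and the rest of [H] is null. *)
Lemma nonopen_subgroup_null H (e : R) : subgroup H -> haar_measurable mu H -> ~ open H ->
  (0 < e)%R -> exists U, [/\ open U, H `<=` U & mu U < e%:E].
Proof.
move=> sgH [B mB [N nullN HBN]] noH e0.
have e20 : (0 < e / 2)%R by rewrite divr_gt0.
have B0 : mu B = 0.
  apply/eqP; rewrite -measure_le0 leNgt; apply/negP => /(steinhaus sgH _ mB) oH.
  by apply/noH/oH; rewrite -HBN; exact: subsetUl.
have [U [oU BU Ue]] : exists U, [/\ open U, B `<=` U & mu U < (e / 2)%:E].
  by apply: outer_regular_lt; rewrite // B0 lte_fin.
have [V [oV NV Ve]] := nullN.2 _ e20.
exists (U `|` V); split; first exact: openU.
  by rewrite -HBN; exact: setUSS.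
apply: le_lt_trans (measureU2 _ _ _) _; [exact: open_borel | exact: open_borel|].
by rewrite [e]splitr EFinD; exact: lteD.
Qed.

(** Stated for varying subgroups because it serves both a constant sequence, for finite index, and
    the increasing subgroups that yield profiniteness. *)
Lemma open_of_countable_cover (H : nat -> set G) (a : nat -> G) :
  (forall n, subgroup (H n)) -> (forall n, haar_measurable mu (H n)) ->
  \bigcup_n [set (a n * h)%g | h in H n] = setT -> exists n, open (H n).
Proof.
move=> sgH mH cover; apply: contrapT => /forallNP noH.
(* These bounds add up to 1/2, less than the measure 1 of the group that the translates of the [U n]
   would cover. *)
have /choice[U UP] n : exists U, [/\ open U, H n `<=` U & mu U < (1 / 2 / (2 ^ n.+1)%:R)%:E].
  by apply: nonopen_subgroup_null => //; rewrite !divr_gt0 // ltr0n expn_gt0.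
have mU n : <<s @open G >> [set (a n * x)%g | x in U n].
  by apply: open_borel; apply: open_lcoset; have [] := UP n.
have : mu setT <= \sum_(0 <= n <oo) mu [set (a n * x)%g | x in U n].
  apply: measure_sigma_subadditive => // x _.
  have : (\bigcup_n [set (a n * h)%g | h in H n]) x by rewrite cover.
  by move=> [n _ [h Hh <-]]; exists n => //; exists h => //; have [_ + _] := UP n; apply.
rewrite probability_setT leNgt => /negP; apply.
apply: (@le_lt_trans _ _ (1 / 2)%:E); last by rewrite lte_fin ltr_pdivrMr // mul1r ltr1n.
apply: le_trans (epsilon_trick0 xpredT _) => //.
apply: lee_nneseries => n _ //.
rewrite (haar_left_invariant muH); first by have [_ _ /ltW] := UP n.
by apply: open_borel; have [] := UP n.
Qed.

Lemma finite_index_open H : subgroup H -> haar_measurable mu H -> finite_index H -> open H.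
Proof.
move=> sgH mH; rewrite /finite_index => fH.
have /finite_setP[n /card_esym/ppcard_eqP[f]] := fH.
(* From index [n] on the representative is arbitrary: the cosets with smaller index already cover
   [G]. *)
have fP i : exists g : G, (i < n)%N -> f i = [set (g * h)%g | h in H].
  have [i_n|] := boolP (i < n)%N; last by exists 1%g.
  have [g _ gE] : [set [set (g * h)%g | h in H] | g in [set: G]] (f i) by exact: (@funS _ _ _ _ f).
  by exists g.
have /choice[a aP] := fP.
have [] := @open_of_countable_cover (fun=> H) a => //.
rewrite -subTset => x _.
have [i /= i_n fi] : (f @` `I_n) [set (x * h)%g | h in H] by rewrite (image_eq f); exists x.
exists i => //; rewrite -aP // fi; exists 1%g; first exact: subgroup1.
by rewrite mulg1.
Qed.

End Steinhaus.

(** * Separation by clopen sets implies profiniteness *)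

Lemma compact_finite_net (T : topologicalType) (K : set T) (E : T -> T -> Prop) :
  compact K -> (forall x, K x -> \forall y \near x, E x y) ->
  exists s : seq T, forall y, K y -> exists2 x, x \in s & E x y.
Proof.
(* Compactness is used in its near-covering form, along the filter of all lists that contain a given
   list. *)
move=> cK KE; pose F := filter_from [set: seq T] (fun s => [set t : seq T | {subset s <= t}]).
have FF : Filter F.
  apply: filter_from_filter; first by exists [::].
  by move=> s t _ _; exists (s ++ t) => // r str; split => x xs; apply: str;
    rewrite mem_cat xs ?orbT.
have /compact_near_coveringP/(_ _ F (fun (s : seq T) y => exists2 x, x \in s & E x y) FF) := cK.
case=> [x Kx|s _ /(_ s) sP]; last by exists s => y Ky; exact: sP.
exists ([set y | E x y], [set s : seq T | x \in s]) => /=.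
  by split; [exact: KE | exists [:: x] => // s; apply; rewrite mem_head].
by move=> [y s] /= [Exy xs]; exists x.
Qed.

Section Profinite.
Context {G : topologicalGroupType}.
Hypothesis cG : compact_group G.

Record open_normal := OpenNormal {
  on_set :> set G ;
  on_open : open on_set ;
  on_subgroup : subgroup on_set ;
  on_normal : forall x y, on_set x -> on_set (y * x * y^-1)%g }.

Lemma subgroupI (H K : set G) : subgroup H -> subgroup K -> subgroup (H `&` K).
Proof.
move=> sgH sgK; split; first by rewrite inE; split; exact: subgroup1.
move=> x y; rewrite !inE => -[Hx Kx] [Hy Ky].
by split; apply: subgroupM => //; exact: subgroupV.
Qed.

Definition open_normalI (N M : open_normal) : open_normal :=
  @OpenNormal (N `&` M) (openI (on_open N) (on_open M))
    (subgroupI (on_subgroup N) (on_subgroup M))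
    (fun x y NMx => conj (on_normal y NMx.1) (on_normal y NMx.2)).

Definition open_normalT : open_normal.
Proof. by refine (@OpenNormal setT openT _ _) => //; split => [|x y _ _]; rewrite inE. Defined.

Lemma clopen_open_normal (U : set G) : clopen U -> U 1%g ->
  exists N : open_normal, N `<=` U.
Proof.
(* N is the largest normal subgroup such that N U = U. *)
move=> [oU cU] U1; pose N := [set x | forall a b, U (a * x * b)%g <-> U (a * b)%g].
have sgN : subgroup N.
  split; first by rewrite inE => a b; rewrite mulg1.
  move=> x y; rewrite !inE => Nx Ny a b.
  have -> : (a * (x * y^-1) * b = a * x * (y^-1 * b))%g by rewrite !mulgA.
  by apply: iff_trans (Nx _ _) _; rewrite -(Ny a) mulgA mulgK.
have N1 : nbhs (1%g : G) N.
  (* For fixed a and b, the products a x b and a b are on the same side of the clopen set [U] once x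
     is near 1; compactness of [G * G] makes this uniform in a and b. *)
  have cGG := compact_setX cG.1 cG.1.
  have : \forall x \near (1%g : G), [set: G] `*` [set: G] `<=`
      (fun ab : G * G => U (ab.1 * x * ab.2)%g <-> U (ab.1 * ab.2)%g).
    have /compact_near_coveringP/(_ _ (nbhs (1%g : G))
      (fun x (ab : G * G) => U (ab.1 * x * ab.2)%g <-> U (ab.1 * ab.2)%g) _) := cGG.
    apply=> -[a b] _.
    have cvg1 : (fun t : G * G * G => t.1.1 * t.2 * t.1.2)%g @ ((a, b), 1%g : G) -->
        (a * 1 * b)%g.
      apply: cvg_mulg; first apply: cvg_mulg; last 2 first.
      - exact: cvg_snd.
      - by apply: (cvg_comp _ _ cvg_fst); exact: cvg_snd.
      - by apply: (cvg_comp _ _ cvg_fst); exact: cvg_fst.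
    have cvg2 : (fun t : G * G * G => t.1.1 * t.1.2)%g @ ((a, b), 1%g : G) --> (a * b)%g.
      apply: cvg_mulg.
      - by apply: (cvg_comp _ _ cvg_fst); exact: cvg_fst.
      - by apply: (cvg_comp _ _ cvg_fst); exact: cvg_snd.
    rewrite mulg1 in cvg1.
    suff : \forall t \near ((a, b), 1%g : G), U (t.1.1 * t.2 * t.1.2)%g <-> U (t.1.1 * t.1.2)%g.
      by [].
    have [Uab|Uab] := pselect (U (a * b)%g).
      have Unb : nbhs (a * b)%g U by apply: open_nbhs_nbhs.
      have n1 : \forall t \near ((a, b), 1%g : G), U (t.1.1 * t.2 * t.1.2)%g := cvg1 _ Unb.
      have n2 : \forall t \near ((a, b), 1%g : G), U (t.1.1 * t.1.2)%g := cvg2 _ Unb.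
      by apply: filterS2 n1 n2 => t.
    have Unb : nbhs (a * b)%g (~` U) by apply: open_nbhs_nbhs; split => //; exact: closed_openC.
    have n1 : \forall t \near ((a, b), 1%g : G), ~ U (t.1.1 * t.2 * t.1.2)%g := cvg1 _ Unb.
    have n2 : \forall t \near ((a, b), 1%g : G), ~ U (t.1.1 * t.1.2)%g := cvg2 _ Unb.
    by apply: filterS2 n1 n2 => t.
  by apply: filterS => x xU a b; exact: (xU (a, b)).
have nN x y : N x -> N (y * x * y^-1)%g.
  move=> Nx a b; have -> : (a * (y * x * y^-1) * b = (a * y) * x * (y^-1 * b))%g.
    by rewrite !mulgA.
  by rewrite Nx mulgA mulgK.
exists (@OpenNormal N (nbhs1_subgroup_open sgN N1) sgN nN) => x Nx.
by have /(_ 1%g 1%g) [_] := Nx; rewrite !mulg1 !mul1g; apply.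
Qed.

Lemma nbhs_coset (N : open_normal) x : \forall y \near x, on_set N (x^-1 * y)%g.
Proof.
apply: lmulg_continuous; rewrite mulVg; apply: open_nbhs_nbhs; split.
  exact: on_open.
exact: (subgroup1 (on_subgroup N)).
Qed.

Section Quotient.
Variable N : open_normal.

Let same x y := on_set N (x^-1 * y)%g.

Let same_sym x y : same x y -> same y x.
Proof. by move=> /(subgroupV (on_subgroup N)); rewrite /same invgM invgK. Qed.

Let same_trans x y z : same x y -> same y z -> same x z.
Proof.
by move=> xy /(subgroupM (on_subgroup N) xy); rewrite /same mulgA mulgK.
Qed.

Let sameMr x y g : same x y -> same (x * g)%g (y * g)%g.
Proof.
move=> /(on_normal g^-1%g); rewrite /same invgK invgM !mulgA; exact.
Qed.

Let same_finite : exists s : seq G, forall x, exists2 y, y \in s & same y x.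
Proof.
have [|s sP] := compact_finite_net (E := same) cG.1; first by move=> x _; exact: nbhs_coset.
by exists s => x; exact: sP.
Qed.

(* G / N is realized as a group of permutations of the cosets of N: G acts by
   right translations, a morphism for the left-to-right product of permutations. *)
Lemma finite_quotient : exists (Q : finGroupType) (pi : G -> Q),
  [/\ {morph pi : x y / (x * y)%g}, forall q, exists x, pi x = q &
      forall x y, pi x = pi y <-> on_set N (x^-1 * y)%g].
Proof.
have [s sP] := same_finite.
(* A coset is encoded by the position of its first representative in the net [s]. *)
pose c x : 'I_(size s).+1 := inord (find (fun y => `[< same y x >]) s).
have cE x y : c x = c y <-> same x y.
  split=> [|xy]; last first.
    congr inord; apply: eq_find => z; apply/asboolP/asboolP => zx.
      exact: same_trans zx xy.
    exact: same_trans zx (same_sym xy).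
  move=> /(congr1 val); rewrite /= !inordK ?ltnS ?find_size // => fxy.
  have hs t : has (fun y => `[< same y t >]) s.
    by apply/hasP; have [u us ut] := sP t; exists u => //; exact/asboolP.
  have /asboolP xz := nth_find 1%g (hs x); have /asboolP yz := nth_find 1%g (hs y).
  by rewrite fxy in xz; exact: same_trans (same_sym xz) yz.
have [rep repP] : exists rep : 'I_(size s).+1 -> G, forall x, c (rep (c x)) = c x.
  have /choice[rep repP] i : exists g, (exists x, c x = i) -> c g = i.
    by have [[x xi]|no] := pselect (exists x, c x = i); [exists x | exists 1%g].
  by exists rep => x; apply: repP; exists x.
(* Numbers that encode no coset stay fixed, so that [rf g] is injective on the whole ordinal
   type. *)
pose rf g i := if c (rep i) == i then c (rep i * g)%g else i.
have rfc g x : rf g (c x) = c (x * g)%g.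
  by rewrite /rf repP eqxx; apply/cE/sameMr/cE.
have rf_inj g : injective (rf g).
  move=> i j; rewrite /rf; case: eqP => [<-|ni]; case: eqP => [<-|nj] //.
  - move=> /cE/(sameMr g^-1%g); rewrite !mulgK => /cE; rewrite !repP; exact.
  - by move=> ij; case: nj; rewrite -ij repP.
  - by move=> ij; case: ni; rewrite ij repP.
pose rho g : 'S_(size s).+1 := perm (@rf_inj g).
have rhoM : {morph rho : x y / (x * y)%g}.
  move=> x y; apply/permP => i; rewrite permM !permE.
  have [<-|/negbTE ni] := eqVneq (c (rep i)) i; first by rewrite !rfc mulgA.
  by rewrite /rf ni ni.
have rho1 : rho 1%g = 1%g.
  by apply: (@mulgI _ (rho 1%g)); rewrite mulg1 -rhoM mulg1.
pose im := [set p : 'S_(size s).+1 | `[< exists g, rho g = p >]]%SET.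
have gim : group_set im.
  apply/group_setP; split=> [|p q]; first by rewrite !inE; exists 1%g.
  by rewrite !inE => -[x <-] [y <-]; exists (x * y)%g.
have imP g : rho g \in Group gim by rewrite !inE; exists g.
exists (subg_of (Group gim)), (fun g => subg (Group gim) (rho g)); split.
- by move=> x y; rewrite rhoM; apply: val_inj; rewrite /= !subgK // groupM.
- move=> q; have := subgP q; rewrite !inE => -[g gq]; exists g.
  by rewrite gq sgvalK.
- move=> x y; split=> [/(congr1 val)|xy].
    rewrite /= !subgK // => /permP/(_ (c 1%g)); rewrite !permE !rfc !mul1g.
    by move/cE.
  congr subg; apply/permP => i; rewrite !permE /rf; case: eqP => // _.
  by apply/cE; rewrite /same invgM !mulgA mulgVK.
Qed.

End Quotient.

Hypothesis separated : forall g : G, g != 1%g -> exists U, [/\ clopen U, U 1%g & ~ U g].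

(** Along the filter of ever smaller open normal subgroups, each point outside the interior of [U]
    is eventually avoided together with a neighbourhood; compactness of that complement makes one
    subgroup avoid all of it. *)
Lemma open_normal_base (U : set G) : nbhs (1%g : G) U -> exists N : open_normal, N `<=` U.
Proof.
move=> U1; pose F := filter_from [set: open_normal] (fun N => [set M : open_normal | M `<=` N]).
have FF : Filter F.
  apply: filter_from_filter; first by exists open_normalT.
  move=> N M _ _; exists (open_normalI N M) => // L LNM.
  by split => x /LNM [].
have cU : compact (~` U°).
  apply: (@subclosed_compact _ _ setT) => //; last exact: cG.1.
  by apply: open_closedC; exact: open_interior.
have : \forall N \near F, ~` U° `<=` ~` (on_set N).
  have /compact_near_coveringP/(_ _ F (fun (N : open_normal) x => ~ on_set N x) FF) := cU.
  apply=> x nUx.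
  have [|V [cV V1 nVx]] := @separated x.
    by apply: contra_notN nUx => /eqP ->.
  have [N NV] := clopen_open_normal cV V1.
  exists (~` V, [set M : open_normal | M `<=` N]) => /=.
    split; last by exists N.
    by apply: open_nbhs_nbhs; split => //; apply: closed_openC; have [] := cV.
  by move=> [y M] /= [nVy MN] /MN/NV.
move=> [N _ /(_ N (fun _ => id)) NU]; exists N => x Nx.
by apply: interior_subset; apply: contrapT => /NU; exact.
Qed.

(** [G] is the inverse limit of its finite quotients by open normal subgroups, ordered by reverse
    inclusion. Transition maps lift to [G] and project again; by [mpE] the choice of lift does not
    matter. *)
Lemma profinite_of_separated : profinite G.
Proof.
pose Q N := projT1 (cid (finite_quotient N)).
pose pi N : G -> Q N := projT1 (cid (projT2 (cid (finite_quotient N)))).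
have [piM piS piE] : [/\ forall N, {morph pi N : x y / (x * y)%g},
    forall N q, exists x, pi N x = q & forall N x y, pi N x = pi N y <-> on_set N (x^-1 * y)%g].
  by split=> N; have [] := projT2 (cid (projT2 (cid (finite_quotient N)))).
pose lift N q := projT1 (cid (piS N q)).
have liftK N q : pi N (lift N q) = q := projT2 (cid (piS N q)).
pose le (N M : open_normal) := M `<=` N.
pose mp N M q := pi N (lift M q).
have mpE N M x : le N M -> mp N M (pi M x) = pi N x.
  by move=> NM; apply/piE/NM/piE; rewrite liftK.
have mpM N M : le N M -> {morph mp N M : x y / (x * y)%g}.
  move=> NM p q; have [x <-] := piS M p; have [y <-] := piS M q.
  by rewrite -piM !mpE // piM.
have mp_id N : mp N N =1 id by move=> q; have [x <-] := piS N q; rewrite mpE.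
have mp_comp N M L : le N M -> le M L -> mp N M \o mp M L =1 mp N L.
  move=> NM ML q; have [x <-] := piS L q; rewrite /= !mpE //.
  exact: subset_trans ML NM.
have dir N M : exists2 L, le N L & le M L.
  by exists (open_normalI N M) => x [].
pose S := @InverseSystem open_normal le (inhabits open_normalT) (fun N => @subset_refl _ N)
  (fun N M L NM ML => subset_trans ML NM) dir Q mp mpM mp_id mp_comp.
exists S, (fun g N => pi N g : discrete_topology (Q N)); split.
- by move=> N x y; exact: piM.
- move=> x y xy; apply: contrapT => nxy.
  have [|V [cV V1 nVx]] := @separated (x^-1 * y)%g.
    by apply: contra_notN nxy => /eqP xy1; rewrite -[y](mulVKg x) xy1 mulg1.
  have [N NV] := clopen_open_normal cV V1.
  apply/nVx/NV/piE.
  exact: (f_equal (fun f : forall N, Q N => f N) xy).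
- apply/seteqP; split => [_ [x _ <-] N M NM|x xlim]; first exact: mpE.
  (* A compatible family gives a filter base of cosets. It clusters at some [g] by compactness, and
     [g] lies in each coset because the cosets are clopen. *)
  pose F := filter_from [set: open_normal] (fun N => [set g | pi N g = x N]).
  have FP : ProperFilter F.
    apply: filter_from_proper; last by move=> N _; have [g] := piS N (x N); exists g.
    apply: filter_from_filter; first by exists open_normalT.
    move=> N M _ _; exists (open_normalI N M) => // g gNM.
    by split; rewrite -(xlim _ (open_normalI N M)) -?gNM; try (by move=> ? []);
      symmetry; apply: mpE => ? [].
  have [g [_ gcl]] := cG.1 F FP filterT.
  exists g => //; apply: functional_extensionality_dep => N.
  have gN : nbhs g [set y | pi N y = pi N g].
    by apply: filterS (nbhs_coset N g) => y /piE.
  have [y [yx yg]] := gcl [set y | pi N y = x N] _ (ex_intro2 _ _ N I (fun=> id)) gN.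
  by rewrite -[RHS]yx -[LHS]yg.
- have cvgp (V : set (isys_prod S)) : open V -> open ((fun g N => pi N g) @^-1` V).
    move=> oV.
    have cp : continuous ((fun g N => pi N g) : G -> isys_prod S).
      move=> g; apply/cvg_sup => N; apply: continuous_comp_initial => {}g.
      apply/discrete_cvg => /=.
      suff : \forall y \near g, pi N y = pi N g by [].
      by apply: filterS (nbhs_coset N g) => y /piE ->.
    by move/continuousP: cp; apply.
  apply/seteqP; split => [U oU|_ [V oV <-]]; last exact: cvgp.
  (* [U] is the preimage of the union of the cylinders that belong to the cosets contained in
     [U]. *)
  pose Vs (i : G * open_normal) := [set y : isys_prod S | y i.2 = pi i.2 i.1].
  exists (\bigcup_(i in [set i | forall z, on_set i.2 (i.1^-1 * z)%g -> U z]) Vs i).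
    apply: bigcup_open => -[x N] _.
    have : continuous ((fun y => y N) : isys_prod S -> discrete_topology (Q N)).
      move=> y; have /cvg_sup/(_ N) yN : nbhs (y : isys_prod S) --> y by exact: cvg_id.
      apply: cvg_trans _ (@initial_continuous _ _ (fun y : isys_prod S => y N) y).
      by apply: cvg_app.
    move=> /continuousP/(_ [set pi N x]); apply; exact: discrete_open.
  apply/seteqP; split => [x [[y N] /= yN xy]|x Ux].
    by apply/yN/piE; exact: esym xy.
  have : nbhs (x * 1)%g U by rewrite mulg1; apply: open_nbhs_nbhs.
  move=> /(@lmulg_continuous _ x) /open_normal_base[N NU].
  by exists (x, N) => // z /NU /=; rewrite mulVKg.
Qed.

End Profinite.

(** * Haar integral of continuous functions *)

Section PartialContinuity.
Context {T X V : topologicalType} (F : T * X -> V) (cF : continuous F).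

Lemma continuous_section1 t : continuous (fun x => F (t, x)).
Proof.
move=> x; apply: (@cvg_comp _ _ _ (fun x => (t, x)) F _ (nbhs (t, x))); last exact: cF.
by apply: cvg_pair; [exact: cvg_cst|exact: cvg_id].
Qed.

Lemma continuous_section2 x : continuous (fun t => F (t, x)).
Proof.
move=> t; apply: (@cvg_comp _ _ _ (fun t => (t, x)) F _ (nbhs (t, x))); last exact: cF.
by apply: cvg_pair; [exact: cvg_id|exact: cvg_cst].
Qed.

Lemma continuous_swap : continuous (fun z => F (z.2, z.1)).
Proof.
move=> z; apply: (@cvg_comp _ _ _ (fun z => (z.2, z.1)) F _ (nbhs (z.2, z.1))); last exact: cF.
by apply: cvg_pair; [exact: cvg_snd|exact: cvg_fst].
Qed.

End PartialContinuity.

(** Compactness of [X] makes continuity in the parameter uniform in the other variable. Fubini and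
    the equicontinuity of convolutions both rest on this. *)
Lemma continuous_near_uniform (R : realType) (T X : topologicalType) (F : T * X -> R) :
  compact [set: X] -> continuous F ->
  forall t e, 0 < e -> \forall t' \near t, forall x, `|F (t', x) - F (t, x)| <= e.
Proof.
move=> cX cF t e e0.
have e20 : 0 < e / 2 by rewrite divr_gt0.
suff : \forall t' \near t, [set: X] `<=` (fun x => `|F (t', x) - F (t, x)| <= e).
  by apply: filterS => t' tt' x; exact: tt'.
have /compact_near_coveringP/(_ _ (nbhs t) (fun t' x => `|F (t', x) - F (t, x)| <= e) _) := cX.
apply=> x _.
have /cvgrPdist_le/(_ _ e20) near1 := cF (t, x).
have near2 : \forall x' \near x, `|F (t, x) - F (t, x')| <= e / 2.
  by have /cvgrPdist_le/(_ _ e20) := continuous_section1 cF (x := x) (t := t).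
suff : \forall z \near (x, t), `|F (z.2, z.1) - F (t, z.1)| <= e by [].
have near1' : \forall z \near (x, t), `|F (t, x) - F (z.2, z.1)| <= e / 2.
  have sw : (fun z : X * T => (z.2, z.1)) @ (x, t) --> (t, x).
    by apply: cvg_pair; [exact: cvg_snd|exact: cvg_fst].
  exact: (sw _ near1).
have near2' : \forall z \near (x, t), `|F (t, x) - F (t, z.1)| <= e / 2.
  exact: (cvg_fst near2).
apply: filterS2 near1' near2' => z /= z1 z2.
rewrite [e]splitr; apply: le_trans (ler_distD (F (t, x)) _ _) _.
by rewrite lerD // distrC.
Qed.

Lemma continuous_sumr (R : realType) (T : topologicalType) (C : Type) (r : seq C)
    (f : C -> T -> R) :
  (forall c, continuous (f c)) -> continuous (fun x => \sum_(c <- r) f c x).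
Proof.
move=> cf; elim: r => [|c r ih] x; first by under eq_fun do rewrite big_nil; exact: cvg_cst.
by under eq_fun do rewrite big_cons; apply: cvgD; [exact: cf | exact: ih].
Qed.

Section HaarIntegral.
Context {R : realType} {G : topologicalGroupType} (mu : probability (borelType G) R).
Hypotheses (cG : compact_group G) (muH : is_haar mu).
Implicit Types (f h : G -> R) (A B K U : set G).

Definition haar_int f : R := Rintegral mu setT (f : borelType G -> R).
Local Notation I := haar_int.

Lemma continuous_integrable f A : continuous f -> <<s @open G >> A ->
  mu.-integrable A (EFin \o f).
Proof.
move=> /[dup] cf /continuousP of_ mA; apply: measurable_bounded_integrable => //.
- by rewrite -ge0_fin_numE //; exact: fin_num_measure.
- apply: measurable_funTS; apply: (measurability _ (RGenOpens.measurableE R)).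
  move=> _ [_ [a [b ->] <-]]; rewrite setTI; apply: open_borel; apply: of_.
  exact: interval_open.
- have : compact (f @` setT).
    by apply: continuous_compact; [exact: continuous_subspaceT | exact: cG.1].
  move=> /compact_bounded[M [Mr fM]]; exists M; split => // r Mr' x _.
  by apply: fM Mr' _ _; exists x.
Qed.

Let intT f : continuous f -> mu.-integrable setT (EFin \o f).
Proof. by move=> cf; apply: continuous_integrable => //; exact: (@measurableT _ (borelType G)). Qed.

Lemma haar_intD f h : continuous f -> continuous h -> I (fun x => f x + h x) = I f + I h.
Proof. by move=> cf ch; apply: RintegralD => //; exact: intT. Qed.

Lemma haar_intB f h : continuous f -> continuous h -> I (fun x => f x - h x) = I f - I h.
Proof. by move=> cf ch; apply: RintegralB => //; exact: intT. Qed.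

Lemma haar_intZ f c : continuous f -> I (fun x => c * f x) = c * I f.
Proof. by move=> cf; apply: RintegralZl => //; exact: intT. Qed.

Lemma haar_int_cst c : I (fun=> c) = c.
Proof.
rewrite /haar_int Rintegral_cst //; transitivity (c * fine (1%:E : \bar R)); last by rewrite mulr1.
congr (_ * fine _); exact: probability_setT.
Qed.

Lemma haar_int_sum (C : Type) (r : seq C) (f : C -> G -> R) :
  (forall c, continuous (f c)) ->
  I (fun x => \sum_(c <- r) f c x) = \sum_(c <- r) I (f c).
Proof.
move=> cf; elim: r => [|c r ih].
  by under eq_fun do rewrite big_nil; rewrite big_nil haar_int_cst.
under eq_fun do rewrite big_cons.
by rewrite big_cons -ih -haar_intD //; exact: continuous_sumr.
Qed.

Lemma le_haar_int f h : continuous f -> continuous h -> (forall x, f x <= h x) -> I f <= I h.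
Proof.
by move=> cf ch fh; apply: le_Rintegral => //; exact: intT.
Qed.

Lemma haar_int_ge0 f : (forall x, 0 <= f x) -> 0 <= I f.
Proof. by move=> f0; exact: Rintegral_ge0. Qed.

Lemma haar_int_lmul f g : continuous f -> I (fun x => f (g * x)%g) = I f.
Proof.
move=> cf.
have mphi : measurable_fun setT ((fun x => g * x)%g : borelType G -> borelType G).
  apply: (@measurability _ _ (borelType G) (borelType G) setT _ (@open G) erefl).
  move=> _ [V oV <-]; rewrite setTI; apply: open_borel.
  by move/continuousP: (@lmulg_continuous _ g); apply.
rewrite /haar_int /Rintegral; congr fine.
have fi : mu.-integrable setT (EFin \o (fun x => f (g * x)%g)).
  apply: intT => x; apply: continuous_comp; first exact: lmulg_continuous.
  exact: cf.
rewrite -[LHS](@integral_pushforward _ _ _ _ _ _ mphi mu setT (EFin \o f)) //; last first.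
  by have /integrableP[] := intT cf.
apply: eq_measure_integral => A mA _; rewrite /= /pushforward.
rewrite -[RHS](haar_left_invariant muH g^-1%g mA) lcosetE invgK //.
Qed.

(* Riemann sums whose nodes and weights depend only on E, not on k. *)
Lemma quadrature (E : G -> G -> Prop) : (forall x, \forall y \near x, E x y) ->
  exists cs : seq (G * R), forall k e, continuous k -> 0 <= e ->
    (forall x y, E x y -> `|k y - k x| <= e) ->
    `|I k - \sum_(c <- cs) c.2 * k c.1| <= e.
Proof.
move=> nE.
have [|s sP] := compact_finite_net (K := [set: G]) (E := fun x y => nbhs y (E x)) cG.1.
  by move=> x _; have := nE x => /near_join.
(* The sets are made disjoint from the end of the list: the piece of [x] is the part of its interior
   that the tail leaves uncovered, and its measure is the weight of the node [x]. *)
pose D := fix D (s : seq G) := if s is x :: s' then (E x)° `|` D s' else set0.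
have mD r : <<s @open G >> (D r).
  elim: r => [|x r ih] /=; first exact: (@measurable0 _ (borelType G)).
  by apply: (@measurableU _ (borelType G)) => //; apply: open_borel; exact: open_interior.
have DT : D s = setT.
  rewrite -subTset => y _; have [x xs Exy] := sP y Logic.I.
  elim: s xs {sP} => // z s ih; rewrite inE => /orP[/eqP <-|/ih]; first by left.
  by right.
suff [cs csP] : exists cs : seq (G * R), forall k e, continuous k -> 0 <= e ->
    (forall x y, E x y -> `|k y - k x| <= e) ->
    `|Rintegral mu (D s) k - \sum_(c <- cs) c.2 * k c.1| <= e * fine (mu (D s)).
  exists cs => k e ck e0 kE; have := csP k e ck e0 kE.
  suff -> : fine (mu (D s)) = 1 by rewrite DT mulr1.
  transitivity (fine (1%:E : \bar R)) => //; congr fine; rewrite DT; exact: probability_setT.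
elim: s {sP DT} => [|x s [cs csP]] /=.
  exists [::] => k e _ e0 _.
  by rewrite Rintegral_set0 big_nil subr0 normr0 mulr_ge0 // fine_ge0.
pose A := (E x)° `\` D s.
have mA : <<s @open G >> A.
  apply: (@measurableD _ (borelType G)); last exact: mD.
  by apply: open_borel; exact: open_interior.
have DA : (E x)° `|` D s = D s `|` A by rewrite setUC setUDr setDv setD0 setUC.
have disj : D s `&` A = set0 by rewrite /A setIDA setIC -setIDA setDv setI0.
exists ((x, fine (mu A)) :: cs) => k e ck e0 kE; rewrite DA big_cons /=.
have intk B : <<s @open G >> B -> mu.-integrable B (EFin \o k) by exact: continuous_integrable.
have cstk B : <<s @open G >> B -> mu.-integrable B (EFin \o (fun=> k x)).
  by apply: continuous_integrable => y; exact: cvg_cst.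
have mDA : <<s @open G >> (D s `|` A) := @measurableU _ (borelType G) _ _ (mD s) mA.
rewrite Rintegral_setU; [|exact: mD|exact: mA|exact: intk mDA|exact/eqP].
have -> : fine (mu (D s `|` A)) = fine (mu (D s)) + fine (mu A).
  rewrite -fineD ?fin_num_measure //; [|exact: mD].
  by congr fine; apply: measureU => //; exact: mD.
rewrite mulrDr.
set a := Rintegral mu (D s) k; set b := Rintegral mu A k; set c := \sum_(_ <- _) _.
have -> : a + b - (fine (mu A) * k x + c) = (a - c) + (b - k x * fine (mu A)) by ring.
apply: le_trans (ler_normD _ _) _; apply: lerD; first exact: csP.
rewrite /b -Rintegral_cst // -RintegralB //; last 2 first.
- exact: intk.
- exact: cstk.
have intB : mu.-integrable A (EFin \o (fun y => k y - k x)).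
  by apply: continuous_integrable => // y; apply: cvgB; [exact: ck | exact: cvg_cst].
apply: le_trans (le_normr_Rintegral _ intB) _ => //.
rewrite -Rintegral_cst //; apply: le_Rintegral => //.
- apply: (continuous_integrable (f := fun y => `|k y - k x|)) => // y.
  by apply: cvg_norm; apply: cvgB; [exact: ck | exact: cvg_cst].
- by apply: (continuous_integrable (f := fun=> e)) => // y; exact: cvg_cst.
- by move=> y [/interior_subset Exy _]; exact: kE.
Qed.

Lemma haar_int_dist f h e : continuous f -> continuous h ->
  (forall x, `|f x - h x| <= e) -> `|I f - I h| <= e.
Proof.
move=> cf ch fh; rewrite -haar_intB // ler_norml.
have cB : continuous (fun x => f x - h x) by move=> x; apply: cvgB; [exact: cf|exact: ch].
have fhe x : - e <= f x - h x <= e by rewrite -ler_norml.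
apply/andP; split.
  by rewrite -(haar_int_cst (- e)); apply: le_haar_int => // x; [exact: cvg_cst|case/andP: (fhe x)].
by rewrite -[leRHS]haar_int_cst; apply: le_haar_int => // x; [exact: cvg_cst|case/andP: (fhe x)].
Qed.

Lemma continuous_param_int (F : G * G -> R) : continuous F ->
  continuous (fun x => I (fun y => F (x, y))).
Proof.
move=> cF x; apply/cvgrPdist_le => e e0.
have := continuous_near_uniform cG.1 cF x e0; apply: filterS => x' xx'.
by rewrite distrC; apply: haar_int_dist => //; exact: continuous_section1.
Qed.

(** No product measure enters. One quadrature in y is accurate to e / 2 for all sections of [F] and
    for their integrals, and finite sums commute with the integral. *)
Lemma haar_fubini (F : G * G -> R) : continuous F ->
  I (fun x => I (fun y => F (x, y))) = I (fun y => I (fun x => F (x, y))).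
Proof.
move=> cF; pose F' z := F (z.2, z.1).
have cF' : continuous F' by exact: continuous_swap.
have cI := continuous_param_int cF; have cI' := continuous_param_int cF'.
apply/eqP; rewrite -subr_eq0 -normr_le0; apply/ler_addgt0Pl => e e0; rewrite addr0.
have e20 : 0 < e / 2 by rewrite divr_gt0.
have [cs csP] := quadrature (fun y => continuous_near_uniform cG.1 cF' y e20).
have cS c : continuous (fun x => c.2 * F (x, c.1)).
  by move=> x; apply: cvgM; [exact: cvg_cst | exact: continuous_section2].
have S1 : I (fun x => \sum_(c <- cs) c.2 * F (x, c.1)) =
    \sum_(c <- cs) c.2 * I (fun x => F (x, c.1)).
  rewrite haar_int_sum //; apply: eq_bigr => c _.
  by rewrite haar_intZ //; exact: continuous_section2.
rewrite [e]splitr; pose S x := \sum_(c <- cs) c.2 * F (x, c.1).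
apply: le_trans (ler_distD (I S) _ _) _; apply: lerD.
  apply: haar_int_dist => // [|x]; first exact: continuous_sumr.
  apply: (csP (fun y => F (x, y))) => //.
  - exact: continuous_section1.
  - exact: ltW.
  - by move=> y y' yy'; exact: yy'.
rewrite S1 distrC; apply: csP => //; first exact: ltW.
move=> y y' yy'; apply: haar_int_dist => [||x]; [exact: continuous_section2..|exact: yy'].
Qed.

End HaarIntegral.

(** * Peter-Weyl theorem *)

Section ContinuousFunctions.
Context {R : realType} {T : topologicalType}.
Implicit Types f h : T -> R.

Lemma contB f h : continuous f -> continuous h -> continuous (fun x => f x - h x).
Proof. by move=> cf ch x; apply: cvgB; [exact: cf | exact: ch]. Qed.

Lemma contM f h : continuous f -> continuous h -> continuous (fun x => f x * h x).
Proof. by move=> cf ch x; apply: cvgM; [exact: cf | exact: ch]. Qed.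

Lemma contZ c f : continuous f -> continuous (fun x => c * f x).
Proof. by move=> cf; apply: contM => // x; exact: cvg_cst. Qed.

End ContinuousFunctions.

Section PeterWeyl.
Context {R : realType} {G : topologicalGroupType} (mu : probability (borelType G) R).
Hypotheses (cG : compact_group G) (muH : is_haar mu).
Implicit Types (f h k : G -> R).
Local Notation I := (haar_int mu).

Lemma cont_lmul f g : continuous f -> continuous (fun x => f (g * x)%g).
Proof.
by move=> cf x; apply: continuous_comp; [exact: lmulg_continuous | exact: cf].
Qed.

(* If f a > 0 then finitely many translates of f add up to a function that is
   bounded below by a positive constant. *)
Lemma haar_int_eq0 f : continuous f -> (forall x, 0 <= f x) -> I f = 0 -> forall x, f x = 0.
Proof.
move=> cf f0 If0 a; apply/eqP; rewrite -[_ == _]negbK; apply/negP => fa.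
have fa0 : 0 < f a by rewrite lt_def fa f0.
have [|s sP] := compact_finite_net (K := [set: G])
    (E := fun x y => f a / 2 <= f (a * x^-1 * y)%g) cG.1.
  move=> x _; have cx := cont_lmul (g := (a * x^-1)%g) cf (x := x).
  have /cvgrPdist_le/(_ _ (divr_gt0 fa0 (ltr0n _ 2))) := cx.
  apply: filterS => y; rewrite mulgVK ler_norml => /andP[_]; lra.
have cs x : continuous (fun y => f (a * x^-1 * y)%g) by exact: cont_lmul.
have : I (fun=> f a / 2) <= I (fun y => \sum_(x <- s) f (a * x^-1 * y)%g).
  apply: le_haar_int => // [x||y]; [exact: cvg_cst|exact: continuous_sumr|].
  have [x xs fx] := sP y Logic.I; apply: le_trans fx _.
  by rewrite (big_rem x xs) /= lerDl sumr_ge0.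
rewrite haar_int_cst haar_int_sum // big1 => [|x _]; last by rewrite haar_int_lmul.
lra.
Qed.

Definition ip f h : R := I (fun x => f x * h x).

Lemma ipC f h : ip f h = ip h f.
Proof. by congr haar_int; apply/funext => x; rewrite mulrC. Qed.

Lemma ipBl f h k : continuous f -> continuous h -> continuous k ->
  ip (fun x => f x - h x) k = ip f k - ip h k.
Proof.
move=> cf ch ck; rewrite /ip -haar_intB //; try exact: contM.
by congr haar_int; apply/funext => x; rewrite mulrBl.
Qed.

Lemma ipZl c f k : continuous f -> continuous k -> ip (fun x => c * f x) k = c * ip f k.
Proof.
move=> cf ck; rewrite /ip -haar_intZ //; last exact: contM.
by congr haar_int; apply/funext => x; rewrite mulrA.
Qed.

Lemma ip_suml n (f : 'I_n -> G -> R) (c : 'I_n -> R) k : (forall i, continuous (f i)) ->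
  continuous k -> ip (fun x => \sum_i c i * f i x) k = \sum_i c i * ip (f i) k.
Proof.
move=> cf ck; rewrite /ip.
transitivity (I (fun x => \sum_i c i * (f i x * k x))).
  by congr haar_int; apply/funext => x; rewrite big_distrl /=; apply: eq_bigr => i _; rewrite mulrA.
have cfk i : continuous (fun x => f i x * k x) by apply: contM => //; exact: cf.
rewrite haar_int_sum // => [|i]; last exact: contZ.
by apply: eq_bigr => i _; rewrite haar_intZ.
Qed.

Lemma ip_lmul g f k : continuous f -> continuous k ->
  ip (fun x => f (g * x)%g) (fun x => k (g * x)%g) = ip f k.
Proof. by move=> cf ck; apply: (haar_int_lmul _ _ _ (contM cf ck)). Qed.

Lemma ip_ge0 f : 0 <= ip f f.
Proof. by apply: haar_int_ge0 => x; rewrite -expr2 sqr_ge0. Qed.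

Lemma ip_eq0 f : continuous f -> ip f f = 0 -> forall x, f x = 0.
Proof.
move=> cf ff0 x; apply/eqP; rewrite -sqrf_eq0 expr2; apply/eqP.
apply: (@haar_int_eq0 (fun x => f x * f x)) => //; first exact: contM.
by move=> y; rewrite -expr2 sqr_ge0.
Qed.

Lemma ip_le f e : continuous f -> 0 <= e -> (forall x, `|f x| <= e) -> ip f f <= e ^+ 2.
Proof.
move=> cf e0 fe; rewrite -[leRHS](haar_int_cst mu); apply: le_haar_int => //; first exact: contM.
  by move=> x; exact: cvg_cst.
by move=> x; rewrite -expr2 -real_normK ?num_real // ler_pXn2r ?nnegrE.
Qed.

Lemma cauchy_schwarz f h : continuous f -> continuous h -> (ip f h) ^+ 2 <= ip f f * ip h h.
Proof.
move=> cf ch; have [hh0|hh0] := eqVneq (ip h h) 0.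
  have h0 := ip_eq0 ch hh0.
  rewrite hh0 mulr0 /ip (_ : (fun x => f x * h x) = fun=> 0) ?haar_int_cst ?expr0n //.
  by apply/funext => x; rewrite h0 mulr0.
have hp : 0 < ip h h by rewrite lt_def hh0 ip_ge0.
pose t := ip f h / ip h h.
have cth : continuous (fun x => t * h x) by exact: contZ.
have cB : continuous (fun x => f x - t * h x) by exact: contB.
have E k : continuous k -> ip (fun x => f x - t * h x) k = ip f k - t * ip h k.
  by move=> ck; rewrite ipBl // ipZl.
have := ip_ge0 (fun x => f x - t * h x).
rewrite E // [ip f _]ipC [ip h _]ipC !E // [ip h f]ipC /t.
have -> : ip f f - ip f h / ip h h * ip f h -
    ip f h / ip h h * (ip f h - ip f h / ip h h * ip h h) =
    (ip f f * ip h h - ip f h ^+ 2) / ip h h.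
  by field.
by rewrite pmulr_lge0 ?invr_gt0 // subr_ge0.
Qed.

(* What the spectral argument needs to know about convolution by a symmetric
   function; the last field says that T maps the unit ball of L^2 to an
   equicontinuous family. *)
Record smoothing (T : (G -> R) -> G -> R) (C : R) : Prop := Smoothing {
  smoothing_cont : forall f, continuous f -> continuous (T f) ;
  smoothingB : forall f h, continuous f -> continuous h ->
    T (fun x => f x - h x) = (fun x => T f x - T h x) ;
  smoothingZ : forall c f, continuous f -> T (fun x => c * f x) = (fun x => c * T f x) ;
  smoothing_sym : forall f h, continuous f -> continuous h -> ip (T f) h = ip f (T h) ;
  smoothing_lmul : forall g f, continuous f ->
    T (fun x => f (g * x)%g) = (fun x => T f (g * x)%g) ;
  smoothing_C : 0 <= C ;
  smoothing_le : forall f x, continuous f -> (T f x) ^+ 2 <= C * ip f f ;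
  smoothing_equicont : forall x e, 0 < e -> \forall y \near x,
    forall f, continuous f -> (T f y - T f x) ^+ 2 <= e * ip f f }.

(** * Convolution operators *)

Section Convolution.
Variables (phi : G -> R) (cphi : continuous phi) (phiV : forall x, phi x^-1%g = phi x).

Definition convolution f x := I (fun y => phi (y^-1 * x)%g * f y).

Let kernel (z : G * G) := phi (z.2^-1 * z.1)%g.

Let ckernel : continuous kernel.
Proof.
move=> z; rewrite /kernel.
apply: (@cvg_comp _ _ _ (fun z : G * G => z.2^-1 * z.1)%g phi _ (nbhs (z.2^-1 * z.1)%g));
  last exact: cphi.
by apply: cvg_mulg; [apply: cvg_invg; exact: cvg_snd | exact: cvg_fst].
Qed.

Let ck x : continuous (fun y => phi (y^-1 * x)%g) := continuous_section1 ckernel (t := x).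

Let ckf f : continuous f -> continuous (fun z => kernel z * f z.2).
Proof.
move=> cf; apply: contM => // z.
by apply: (@cvg_comp _ _ _ (fun z : G * G => z.2) f _ (nbhs z.2)); [exact: cvg_snd | exact: cf].
Qed.

(** Symmetry is Fubini together with [phiV], and commutation with left translations is the
    invariance of [mu]. The last two bounds are Cauchy-Schwarz against the kernel, which is bounded
    and, near each x, uniformly continuous in y. *)
Lemma convolution_smoothing : exists C, smoothing convolution C.
Proof.
have [M M0 phiM] : exists2 M, 0 <= M & forall x, `|phi x| <= M.
  have : compact (phi @` setT).
    by apply: continuous_compact; [exact: continuous_subspaceT | exact: cG.1].
  move=> /compact_bounded[M [_ fM]]; exists (`|M| + 1); first by rewrite addr_ge0.
  move=> x; apply: (fM (`|M| + 1)); last by exists x.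
  by rewrite ltr_pwDr // ler_norm.
exists (M ^+ 2); split.
- by move=> f cf; apply: continuous_param_int (ckf cf).
- move=> f h cf ch; apply/funext => x; rewrite /convolution -haar_intB //; try exact: contM.
  by congr haar_int; apply/funext => y; rewrite mulrBr.
- move=> c f cf; apply/funext => x; rewrite /convolution -haar_intZ //; last exact: contM.
  by congr haar_int; apply/funext => y; rewrite mulrCA.
- move=> f h cf ch; rewrite /ip /convolution.
  transitivity (I (fun x => I (fun y => kernel (x, y) * f y * h x))).
    congr haar_int; apply/funext => x; rewrite mulrC -haar_intZ //; last exact: contM.
    by congr haar_int; apply/funext => y; rewrite mulrC.
  rewrite (@haar_fubini _ _ mu cG (fun z => kernel z * f z.2 * h z.1)); last first.
    apply: contM; first exact: ckf.
    move=> z; apply: (@cvg_comp _ _ _ (fun z : G * G => z.1) h _ (nbhs z.1)); last exact: ch.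
    exact: cvg_fst.
  congr haar_int; apply/funext => y; rewrite -haar_intZ //; last exact: contM.
  congr haar_int; apply/funext => x; rewrite /kernel /= -(phiV (x^-1 * y)%g) invgM invgK.
  by rewrite mulrCA mulrA.
- move=> g f cf; apply/funext => x; rewrite /convolution.
  rewrite -(@haar_int_lmul _ _ _ cG muH (fun y => phi (y^-1 * (g * x))%g * f y) g); last first.
    exact: contM.
  by congr haar_int; apply/funext => y; rewrite invgM !mulgA mulgVK.
- exact: sqr_ge0.
- move=> f x cf; apply: le_trans (cauchy_schwarz (ck (x := x)) cf) _.
  by apply: ler_wpM2r; [exact: ip_ge0 | exact: ip_le].
- move=> x e e0; have se0 : 0 < Num.sqrt e by rewrite sqrtr_gt0.
  have := continuous_near_uniform cG.1 ckernel x se0; apply: filterS => x' xx' f cf.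
  rewrite /convolution -haar_intB //; try exact: contM.
  under eq_fun do rewrite -mulrBl.
  apply: le_trans (@cauchy_schwarz (fun y => phi (y^-1 * x')%g - phi (y^-1 * x)%g) f _ cf) _.
    exact: contB.
  apply: ler_wpM2r; first exact: ip_ge0.
  rewrite -(sqr_sqrtr (ltW e0)); apply: ip_le => //.
  exact: contB.
Qed.

End Convolution.

End PeterWeyl.

Lemma abs_le (R : realDomainType) (a b : R) : 0 <= b -> a ^+ 2 <= b ^+ 2 -> `|a| <= b.
Proof. by move=> b0 ab; rewrite -(ler_pXn2r (n:=2)) ?nnegrE // real_normK ?num_real. Qed.

Lemma fmap_ultra T V (f : T -> V) (F : set_system T) : UltraFilter F -> UltraFilter (f @ F).
Proof.
move=> FU; split; first exact: fmap_proper_filter.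
move=> H HP FH; apply/seteqP; split => [A HA|]; last exact: FH.
have [//|FnA] := in_ultra_setVsetC (f @^-1` A) FU.
by have [x []] := filter_ex (filterI HA (FH (~` A) FnA)).
Qed.

(** * Eigenfunctions of the square of a smoothing operator *)

Section Eigenfunctions.
Context {R : realType} {G : topologicalGroupType} (mu : probability (borelType G) R).
Hypotheses (cG : compact_group G) (muH : is_haar mu).
Variables (T : (G -> R) -> G -> R) (C : R) (sT : smoothing mu T C).
Implicit Types (f h k : G -> R).
Local Notation ip := (ip mu).

Let cT f : continuous f -> continuous (T f).
Proof. exact: (smoothing_cont sT). Qed.

Let C0 := smoothing_C sT.

Lemma smoothing_ip_le f : continuous f -> ip (T f) (T f) <= C * ip f f.
Proof.
move=> cf; have Cf0 : 0 <= C * ip f f by rewrite mulr_ge0 ?ip_ge0.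
rewrite -[leRHS]sqr_sqrtr //; apply: ip_le => //; first exact: cT.
move=> x; rewrite -sqrtr_sqr; apply: ler_wsqrtr; exact: (smoothing_le sT).
Qed.

Lemma smoothing_comp : smoothing mu (T \o T) (C * C).
Proof.
split=> /=.
- by move=> f cf; do 2!apply: cT.
- move=> f h cf ch; rewrite (smoothingB sT) // (smoothingB sT) //; exact: cT.
- move=> c f cf; rewrite (smoothingZ sT) // (smoothingZ sT) //; exact: cT.
- move=> f h cf ch; rewrite (smoothing_sym sT) // ?(smoothing_sym sT) //; exact: cT.
- move=> g f cf; rewrite (smoothing_lmul sT) // (smoothing_lmul sT) //; exact: cT.
- by rewrite mulr_ge0.
- move=> f x cf; apply: le_trans (smoothing_le sT _ (cT cf)) _.
  by rewrite -mulrA ler_wpM2l // smoothing_ip_le.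
(* Dividing by [C + 1] also covers the case where [C] is zero. *)
- move=> x e e0; have e1 : 0 < e / (C + 1) by rewrite divr_gt0 // ltr_pwDr.
  have := smoothing_equicont sT x e1; apply: filterS => y yx f cf.
  apply: le_trans (yx _ (cT cf)) _.
  apply: (@le_trans _ _ (e / (C + 1) * (C * ip f f))).
    by rewrite ler_wpM2l ?smoothing_ip_le // ltW.
  have C1 : 0 < C + 1 by rewrite ltr_pwDr.
  rewrite mulrA ler_wpM2r ?ip_ge0 // -mulrA ler_piMr ?(ltW e0) // mulrC.
  by rewrite ler_pdivrMr // mul1r lerDl.
Qed.

Variable Z : set (G -> R).
Hypothesis cZ : forall k, Z k -> continuous k.

(** In the application [Z] consists of the continuous functions fixed by a group element, and the
    eigenfunction is sought orthogonally to them. *)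
Definition perp f := continuous f /\ forall k, Z k -> ip f k = 0.

Hypothesis TZ : forall f, perp f -> perp (T f).
Hypothesis T_neq0 : exists2 f, perp f & 0 < ip (T f) (T f).

Let S1 := [set ip (T f) (T f) | f in [set f | perp f /\ ip f f <= 1]].

(** The square of the operator norm of [T] on [perp], which turns out to be an eigenvalue of
    [T \o T]. *)
Let M := sup S1.

Let perpZ c f : perp f -> perp (fun x => c * f x).
Proof.
move=> [cf fZ]; split; first exact: contZ.
by move=> k Zk; rewrite ipZl //; [rewrite fZ // mulr0 | exact: cZ].
Qed.

Let ipZZ c f : continuous f -> ip (fun x => c * f x) (fun x => c * f x) = c ^+ 2 * ip f f.
Proof.
move=> cf; have ccf : continuous (fun x => c * f x) by exact: contZ.
by rewrite ipZl // ipC ipZl // mulrA expr2.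
Qed.

Let S1_bounded : has_ubound S1.
Proof.
exists C => _ [f [[cf _] f1] <-]; apply: le_trans (smoothing_ip_le cf) _.
by rewrite ler_piMr.
Qed.

Let normalize f : perp f -> 0 < ip f f ->
  S1 (ip (T f) (T f) / ip f f).
Proof.
move=> of_ f0; have cf := of_.1; have s0 : 0 < Num.sqrt (ip f f) by rewrite sqrtr_gt0.
have E : (Num.sqrt (ip f f))^-1 ^+ 2 = (ip f f)^-1 by rewrite exprVn sqr_sqrtr // ltW.
exists (fun x => (Num.sqrt (ip f f))^-1 * f x).
  by split; [exact: perpZ | rewrite ipZZ // E mulVf // gt_eqF].
rewrite (smoothingZ sT) // ipZZ; last exact: cT.
by rewrite E mulrC.
Qed.

Let TM f : perp f -> ip (T f) (T f) <= M * ip f f.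
Proof.
move=> of_; have [f0|f0] := eqVneq (ip f f) 0.
  by rewrite f0 mulr0; have := smoothing_ip_le of_.1; rewrite f0 mulr0.
have fp : 0 < ip f f by rewrite lt_def f0 ip_ge0.
rewrite -ler_pdivrMr //; apply: ub_le_sup => //; exact: normalize.
Qed.

Let M0 : 0 < M.
Proof.
have [f of_ Tf0] := T_neq0.
have := TM of_; have := ip_ge0 mu f; rewrite le_eqVlt => /predU1P[<-|fp].
  by rewrite mulr0 leNgt Tf0.
by move=> /(lt_le_trans Tf0); rewrite pmulr_lgt0.
Qed.

Let near_sup e : 0 < e -> exists f, [/\ perp f, ip f f <= 1 & M - e < ip (T f) (T f)].
Proof.
move=> e0; have [|_ [f [of_ f1] <-] Mf] := @sup_adherent _ S1 _ e0.
  split; last exact: S1_bounded.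
  have [f of_ Tf0] := T_neq0; exists (ip (T f) (T f) / ip f f); apply: normalize => //.
  by have := lt_le_trans Tf0 (TM of_); rewrite pmulr_rgt0.
by exists f.
Qed.

(** For a maximizing sequence [f n], the functions [u n] and [M * f n] become close in L^2 norm
    ([uMf]). Applying [T \o T] turns this into pointwise closeness of [T (T (u n))] and [M * u n],
    and the limit [h] of the [u n] inherits the eigenvalue equation. *)
Theorem eigenfunction : exists m h, [/\ 0 < m, perp h, 0 < ip h h &
  forall x, T (T h) x = m * h x].
Proof.
have sU := smoothing_comp.
have e_gt0 n : 0 < (n.+1%:R : R)^-1 by rewrite invr_gt0.
have [f fP] := choice (fun n => near_sup (e_gt0 n)).
have fo n : perp (f n) by have [] := fP n.
have cf n : continuous (f n) := (fo n).1.
have f1 n : ip (f n) (f n) <= 1 by have [] := fP n.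
pose u n := T (T (f n)).
have cu n : continuous (u n) by do 2!apply: cT.
(* An ultrafilter gives the bounded sequences [u n x] limits at all points at once; equicontinuity
   then makes the convergence uniform, as in the Arzela-Ascoli theorem. *)
have [U [UU Uoo]] := ultraFilterLemma (eventually_filter : ProperFilter \oo).
have uC n x : `|u n x| <= C.
  rewrite -(ler_pXn2r (n:=2)) ?nnegrE // real_normK ?num_real //.
  apply: le_trans (smoothing_le sU _ (cf n)) _.
  by rewrite expr2 ler_piMr // mulr_ge0.
have u_cvg x : exists l : R, u n x @[n --> U] --> l.
  have FU : UltraFilter (u n x @[n --> U]) by exact: fmap_ultra.
  have := @segment_compact R (- C) C; rewrite compact_ultra.
  case/(_ _ FU) => [|l [_ ul]]; last by exists l.
  suff : \forall n \near U, u n x \in `[- C, C] by [].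
  by apply: filterE => n; rewrite in_itv /= -ler_norml.
have [h hP] := choice u_cvg.
have hu x e : 0 < e -> \forall n \near U, `|u n x - h x| <= e.
  by move=> e0; have /cvgr_dist_le/(_ _ e0) := hP x; apply: filterS => n; rewrite distrC.
have u_equi x e : 0 < e -> \forall y \near x, forall n, `|u n y - u n x| <= e.
  move=> e0; have := smoothing_equicont sU x (exprn_gt0 2 e0); apply: filterS => y yx n.
  rewrite -(ler_pXn2r (n:=2)) ?nnegrE ?(ltW e0) // real_normK ?num_real //.
  apply: le_trans (yx _ (cf n)) _; by rewrite ler_piMr // sqr_ge0.
have h_equi x e : 0 < e -> \forall y \near x, `|h y - h x| <= e.
  move=> e0; have e30 : 0 < e / 3 by rewrite divr_gt0.
  have := u_equi x _ e30; apply: filterS => y uyx.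
  have [n [uy ux]] := filter_ex (filterI (hu y _ e30) (hu x _ e30)).
  have := uyx n; rewrite !ler_norml in uy ux *; lra.
have ch : continuous h.
  by move=> x; apply/cvgrPdist_le => e e0; apply: filterS (h_equi x _ e0) => y; rewrite distrC.
have near_u e : 0 < e -> \forall n \near U, forall x, `|u n x - h x| <= e.
  move=> e0; have e30 : 0 < e / 3 by rewrite divr_gt0.
  suff : \forall n \near U, [set: G] `<=` (fun x => `|u n x - h x| <= e).
    by apply: filterS => n un x; exact: un.
  have /compact_near_coveringP/(_ _ U (fun n x => `|u n x - h x| <= e) _) := cG.1.
  apply=> x _.
  exists ([set y | (forall n, `|u n y - u n x| <= e / 3) /\ `|h y - h x| <= e / 3],
      [set n | `|u n x - h x| <= e / 3]) => /=.
    by split; [exact: filterI (u_equi x _ e30) (h_equi x _ e30) | exact: hu].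
  move=> [y n] /= [[/(_ n) uy hy] un]; rewrite !ler_norml in uy hy un *; lra.
have approx e : 0 < e -> exists n, (forall x, `|u n x - h x| <= e) /\
    M - e < ip (T (f n)) (T (f n)).
  move=> e0; have near_inv : \forall n \near U, (n.+1%:R : R)^-1 < e.
    by apply: Uoo; exact: near_infty_natSinv_lt (PosNum e0).
  have [n [nu ne]] := filter_ex (filterI (near_u e e0) near_inv).
  exists n; split=> //; have [_ _] := fP n; apply: le_lt_trans.
  by rewrite lerD2l lerN2 ltW.
have ip_small n e : 0 < e -> (forall x, `|u n x - h x| <= e) ->
    ip (fun x => u n x - h x) (fun x => u n x - h x) <= e ^+ 2.
  by move=> e0 un; apply: ip_le => //; [exact: contB | exact: ltW].
have uf n : ip (u n) (f n) = ip (T (f n)) (T (f n)).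
  by rewrite /u (smoothing_sym sT) //; exact: cT.
(* Expand the square: [ip (u n) (u n)] is at most [M * ip (T (f n)) (T (f n))], the mixed term is
   [ip (T (f n)) (T (f n))] by symmetry, and [ip (f n) (f n)] is at most 1. *)
have uMf n : ip (fun x => u n x - M * f n x) (fun x => u n x - M * f n x) <=
    M * (M - ip (T (f n)) (T (f n))).
  have cMf : continuous (fun x => M * f n x) by exact: contZ.
  have E k : continuous k -> ip (fun x => u n x - M * f n x) k = ip (u n) k - M * ip (f n) k.
    by move=> ck; rewrite ipBl // ipZl.
  have cB : continuous (fun x => u n x - M * f n x) by exact: contB.
  rewrite E // [ip (u n) _]ipC [ip (f n) _]ipC !E // [ip (f n) (u n)]ipC uf.
  have uu : ip (u n) (u n) <= M * ip (T (f n)) (T (f n)) by apply: TM; exact: TZ.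
  have ffM : M * (M * ip (f n) (f n)) <= M * M.
    by rewrite ler_pM2l // ger_pMr.
  move: uu ffM; nra.
exists M, h; split => //.
- split => // k Zk; have ck := cZ Zk; apply/eqP; rewrite -normr_le0; apply/ler_addgt0Pl => e e0.
  rewrite addr0; pose d := e / (1 + Num.sqrt (ip k k)).
  have s0 : 0 < 1 + Num.sqrt (ip k k) by rewrite ltr_pwDl.
  have d0 : 0 < d by rewrite divr_gt0.
  have [n [un _]] := approx d d0.
  have : (ip (fun x => u n x - h x) k) ^+ 2 <= d ^+ 2 * ip k k.
    apply: le_trans (cauchy_schwarz cG muH _ ck) _; first exact: contB.
    by rewrite ler_wpM2r ?ip_ge0 // ip_small.
  have un0 : ip (u n) k = 0 by have [_] := TZ (TZ (fo n)); apply.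
  rewrite ipBl // un0 sub0r sqrrN -(sqr_sqrtr (ip_ge0 mu k)) -exprMn.
  move=> /(abs_le (mulr_ge0 (ltW d0) (sqrtr_ge0 _))) /le_trans; apply.
  by rewrite -[leRHS](divfK (lt0r_neq0 s0)) ler_wpM2l ?(ltW d0) // lerDr.
(* If [h] were zero, [u n] would be at most M / 4 in absolute value, hence so would
   [ip (u n) (f n)], although this number exceeds M - M / 4. *)
- rewrite lt_def ip_ge0 andbT; apply/eqP => h0.
  have {}h0 := ip_eq0 cG muH ch h0.
  have M40 : 0 < M / 4 by rewrite divr_gt0.
  have [n [un nM]] := approx _ M40.
  have : (ip (u n) (f n)) ^+ 2 <= (M / 4) ^+ 2.
    apply: le_trans (cauchy_schwarz cG muH (cu n) (cf n)) _.
    apply: (@le_trans _ _ (ip (u n) (u n))); first by rewrite ler_piMr // ip_ge0.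
    by apply: ip_le => // [|x]; [exact: ltW | have := un x; rewrite h0 subr0].
  move=> /(abs_le (ltW M40)); rewrite uf => /ler_normlW; lra.
- move=> x; apply/eqP; rewrite -subr_eq0 -normr_le0; apply/ler_addgt0Pl => e e0; rewrite addr0.
  pose D := C * C; have D0 : 0 <= D by rewrite mulr_ge0.
  (* The errors [t1], [t2], [t3] below are at most a d, b d and M d, and [d] makes their sum at most
     [e]. The bound d ^ 2 on the defect from [M] is for [t2], where a square root is taken. *)
  pose a := Num.sqrt D; pose b := Num.sqrt (D * M); pose d := e / (1 + a + b + M).
  have s0 : 0 < 1 + a + b + M by rewrite ltr_wpDl // !addr_ge0 ?sqrtr_ge0.
  have d0 : 0 < d by rewrite divr_gt0.
  have dd0 : 0 < Num.min d (d ^+ 2) by rewrite lt_min d0 exprn_gt0.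
  have [n [/= un nM]] := approx _ dd0.
  have {}un y : `|u n y - h y| <= d by apply: le_trans (un y) _; rewrite ge_min lexx.
  have {}nM : M - ip (T (f n)) (T (f n)) <= d ^+ 2.
    rewrite lerBlDr -lerBlDl; apply: ltW; apply: le_lt_trans nM.
    by rewrite lerD2l lerN2 ge_min lexx orbT.
  have cMf : continuous (fun y => M * f n y) by exact: contZ.
  have t1 : `|T (T (u n)) x - T (T h) x| <= a * d.
    apply: abs_le; first by rewrite mulr_ge0 ?sqrtr_ge0 // ltW.
    have := smoothingB sU (cu n) ch; move/(congr1 (fun k => k x)) => /= <-.
    apply: le_trans (smoothing_le sU x (contB (cu n) ch)) _.
    by rewrite exprMn sqr_sqrtr // ler_wpM2l // ip_small.
  have t2 : `|T (T (u n)) x - M * u n x| <= b * d.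
    apply: abs_le; first by rewrite mulr_ge0 ?sqrtr_ge0 // ltW.
    have := smoothingB sU (cu n) cMf; move/(congr1 (fun k => k x)).
    have := smoothingZ sU M (cf n); move/(congr1 (fun k => k x)) => /= -> <-.
    apply: le_trans (smoothing_le sU x (contB (cu n) cMf)) _.
    rewrite exprMn sqr_sqrtr; last by rewrite mulr_ge0 // ltW.
    rewrite -[D * M * _]mulrA ler_wpM2l //; apply: le_trans (uMf n) _.
    by rewrite ler_wpM2l // ltW.
  have t3 : `|M * u n x - M * h x| <= M * d.
    by rewrite -mulrBr normrM gtr0_norm // ler_wpM2l // ltW.
  have : e = d + a * d + b * d + M * d.
    by rewrite -{1}[d]mul1r -!mulrDl mulrC divfK // lt0r_neq0.
  move: t1 t2 t3; rewrite !ler_norml; lra.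
Qed.

End Eigenfunctions.

(** * Finite-dimensional eigenspaces and their translation representations *)

Section Eigenspace.
Context {R : realType} {G : topologicalGroupType} (mu : probability (borelType G) R).
Hypotheses (cG : compact_group G) (muH : is_haar mu).
Variables (T : (G -> R) -> G -> R) (C : R) (sT : smoothing mu T C) (m : R) (m0 : 0 < m).
Implicit Types (f h k : G -> R).
Local Notation I := (haar_int mu).
Local Notation ip := (ip mu).

Definition eigenspace f := continuous f /\ forall x, T f x = m * f x.

Lemma eigenspace_comb n (c : 'I_n -> R) (e : 'I_n -> G -> R) : (forall i, eigenspace (e i)) ->
  eigenspace (fun x => \sum_i c i * e i x).
Proof.
move=> eE; elim: n c e eE => [|n ih] c e eE.
  have -> : (fun x => \sum_(i < 0) c i * e i x) = (fun=> 0 * 0).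
    by apply/funext => x; rewrite big_ord0 mul0r.
  have c0 : continuous (fun _ : G => 0 : R) by move=> x; exact: cvg_cst.
  split=> [x|x]; first exact: cvg_cst.
  by rewrite (smoothingZ sT 0 c0) !mul0r mulr0.
have [cS TS] := ih (fun i => c (lift ord0 i)) (fun i => e (lift ord0 i)) (fun i => eE _).
have [ce Te] := eE ord0.
(* [smoothing] speaks of differences and multiples, so the sum is written as a difference with
   factor -1. *)
have -> : (fun x => \sum_i c i * e i x) =
    fun x => c ord0 * e ord0 x - (- 1) * \sum_i c (lift ord0 i) * e (lift ord0 i) x.
  by apply/funext => x; rewrite big_ord_recl mulN1r opprK.
have c1 := contZ (c := - 1) cS; have c2 := contZ (c := c ord0) ce.
split; first exact: contB.
move=> x; rewrite (smoothingB sT c2 c1) (smoothingZ sT _ cS) (smoothingZ sT _ ce) TS Te.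
by ring.
Qed.

Definition orthonormal_sys n (e : 'I_n -> G -> R) :=
  (forall i, eigenspace (e i)) /\ forall i j, ip (e i) (e j) = (i == j)%:R.

Lemma ip_comb n (e : 'I_n -> G -> R) (c : 'I_n -> R) j : orthonormal_sys e ->
  ip (fun x => \sum_i c i * e i x) (e j) = c j.
Proof.
move=> [eE eo]; have ce i : continuous (e i) := (eE i).1.
rewrite ip_suml //.
rewrite (bigD1 j) //= eo eqxx mulr1 big1 ?addr0 // => i /negbTE ij.
by rewrite eo ij mulr0.
Qed.

(* Apply T f x ^ 2 <= C * ip f f to f = sum_i (e i x) e i, and integrate over x. *)
Lemma orthonormal_bound n (e : 'I_n -> G -> R) : orthonormal_sys e -> n%:R <= C / m ^+ 2.
Proof.
move=> oe; have [eE eo] := oe; have ce i : continuous (e i) := (eE i).1.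
have cee i : continuous (fun x => e i x * e i x) by exact: contM.
have bound x : \sum_i e i x * e i x <= C / m ^+ 2.
  have [cf Tf] := eigenspace_comb (fun i => e i x) eE.
  have ff : ip (fun y => \sum_i e i x * e i y) (fun y => \sum_i e i x * e i y) =
      \sum_i e i x * e i x.
    rewrite ip_suml //; apply: eq_bigr => i _; rewrite ipC ip_comb //.
  have := smoothing_le sT x cf; rewrite Tf ff exprMn.
  set s := \sum_i _; have s0 : 0 <= s by apply: sumr_ge0 => i _; rewrite -expr2 sqr_ge0.
  rewrite ler_pdivlMr ?exprn_gt0 // => le_s.
  have [->|sn0] := eqVneq s 0; first by rewrite mul0r (smoothing_C sT).
  have sp : 0 < s by rewrite lt_def sn0.
  by rewrite -(ler_pM2r sp) mulrAC mulrC -expr2.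
have <- : I (fun x => \sum_i e i x * e i x) = n%:R.
  rewrite haar_int_sum // (eq_bigr (fun=> 1)) => [|i _]; first by rewrite sumr_const card_ord.
  by have := eo i i; rewrite eqxx.
rewrite -[leRHS](haar_int_cst mu); apply: le_haar_int => //; first exact: continuous_sumr.
by move=> x; exact: cvg_cst.
Qed.

(** The sizes of orthonormal systems are bounded, so one of maximal size exists. If the part of [f]
    orthogonal to it were nonzero, it could be normalized and appended. *)
Lemma orthonormal_basis : exists n (e : 'I_n -> G -> R), orthonormal_sys e /\
  forall f, eigenspace f -> forall x, f x = \sum_i ip f (e i) * e i x.
Proof.
pose P n := `[< exists e : 'I_n -> G -> R, orthonormal_sys e >].
have P0 : exists n, P n.
  by exists 0%N; apply/asboolP; exists (fun _ _ => 0); split => -[].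
have Pb n : P n -> (n <= Num.truncn (C / m ^+ 2))%N.
  move=> /asboolP[e /orthonormal_bound Cm]; rewrite truncn_ge_nat //.
  by rewrite divr_ge0 ?(smoothing_C sT) // sqr_ge0.
case: (ex_maxnP P0 Pb) => n /asboolP[e oe] nmax; exists n, e; split => // f Ef.
have [eE eo] := oe; have ce i : continuous (e i) := (eE i).1; have cf := Ef.1.
have [cs Ts] := eigenspace_comb (fun i => ip f (e i)) eE.
pose r x := f x - \sum_i ip f (e i) * e i x.
have cr : continuous r by exact: contB.
have Tr x : T r x = m * r x.
  by rewrite (smoothingB sT cf cs) Ts Ef.2 /r mulrBr.
have re j : ip r (e j) = 0 by rewrite ipBl // ip_comb // subrr.
suff rr0 : ip r r = 0.
  by move=> x; apply/eqP; rewrite -subr_eq0; apply/eqP; exact: (ip_eq0 cG muH cr rr0 x).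
apply/eqP; rewrite -[_ == _]negbK; apply/negP => rr0.
have rp : 0 < ip r r by rewrite lt_def rr0 ip_ge0.
pose c := (Num.sqrt (ip r r))^-1.
have ccr : continuous (fun x => c * r x) by exact: contZ.
pose e' (i : 'I_n.+1) := if unlift ord_max i is Some j then e j else fun x => c * r x.
suff oe' : orthonormal_sys e'.
  by have := nmax n.+1; rewrite ltnn => /(_ (asboolT (ex_intro _ e' oe'))).
split=> [i|i j]; rewrite /e'.
  case: unliftP => [j _|_]; first exact: eE.
  split=> // x; rewrite (smoothingZ sT _ cr) Tr; ring.
case: unliftP => [a ->|->]; case: unliftP => [b ->|->].
- by rewrite eo (inj_eq lift_inj).
- by rewrite ipC ipZl // re mulr0 eq_sym (negbTE (neq_lift _ _)).
- by rewrite ipZl // re mulr0 (negbTE (neq_lift _ _)).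
- rewrite eqxx ipZl // ipC ipZl // mulrA -expr2 /c exprVn sqr_sqrtr ?(ltW rp) // mulVf //.
Qed.

(** [rho g] is the matrix, in an orthonormal basis, of the action of [g] on the eigenspace by left
    translation. It is orthogonal since translations preserve [ip]. *)
Theorem eigenspace_representation : exists n (rho : G -> 'M[R]_n),
  [/\ forall x y, rho (x * y)%g = rho x *m rho y, forall x, rho x^-1%g = (rho x)^T,
      rho 1%g = 1%:M, forall i j, continuous (fun x => rho x i j) &
      forall g, rho g = 1%:M -> forall f, eigenspace f -> forall x, f (g^-1 * x)%g = f x].
Proof.
have [n [e [oe span]]] := orthonormal_basis; have [eE eo] := oe.
have ce i : continuous (e i) := (eE i).1.
have cL g i : continuous (fun x => e i (g * x)%g) by exact: cont_lmul.
have EL g f : eigenspace f -> eigenspace (fun x => f (g * x)%g).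
  move=> [cf Tf]; split; first exact: cont_lmul.
  by move=> x; rewrite (smoothing_lmul sT) // Tf.
pose rho g := \matrix_(i, j) ip (fun x => e j (g^-1 * x)%g) (e i).
have expand g j x : e j (g^-1 * x)%g = \sum_i rho g i j * e i x.
  rewrite (span (fun x => e j (g^-1 * x)%g)); last exact: EL.
  by apply: eq_bigr => i _; rewrite mxE.
exists n, rho; split.
- move=> x y; apply/matrixP => i j; rewrite !mxE.
  have -> : (fun z => e j ((x * y)^-1 * z)%g) = fun z => \sum_k rho y k j * e k (x^-1 * z)%g.
    by apply/funext => z; rewrite invgM -mulgA expand.
  rewrite ip_suml //; apply: eq_bigr => k _; by rewrite mulrC !mxE.
- move=> x; apply/matrixP => i j; rewrite !mxE invgK.
  rewrite -(ip_lmul cG muH x^-1%g) //; rewrite ipC.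
  by congr haar_int; apply/funext => z; rewrite mulVKg.
- apply/matrixP => i j; rewrite !mxE -[RHS]/((i == j)%:R) eq_sym -eo.
  by congr haar_int; apply/funext => z; rewrite invg1 mul1g.
- move=> i j; under eq_fun do rewrite mxE.
  apply: (@continuous_param_int _ _ mu cG (fun z => e j (z.1^-1 * z.2)%g * e i z.2)).
  apply: contM => z.
    apply: (@cvg_comp _ _ _ (fun z : G * G => z.1^-1 * z.2)%g (e j) _ (nbhs (z.1^-1 * z.2)%g)).
      by apply: cvg_mulg; [apply: cvg_invg; exact: cvg_fst | exact: cvg_snd].
    exact: ce.
  by apply: (@cvg_comp _ _ _ (fun z : G * G => z.2) (e i) _ (nbhs z.2)); [exact: cvg_snd|exact: ce].
- move=> g g1 f Ef x; rewrite (span f Ef x) (span f Ef (g^-1 * x)%g).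
  apply: eq_bigr => i _; rewrite expand g1 (bigD1 i) //= mxE eqxx mul1r big1 ?addr0 // => k ki.
  by rewrite mxE (negbTE ki) mul0r.
Qed.

End Eigenspace.

(** * A representation that moves a given element *)

Section Separation.
Context {R : realType} {G : topologicalGroupType} (mu : probability (borelType G) R).
Hypotheses (cG : compact_group G) (muH : is_haar mu).

(** A Urysohn function supported in a neighbourhood [W] of 1 disjoint from g W is multiplied by its
    reflection. The symmetry makes convolution by [phi] self-adjoint; the disjointness makes [phi]
    differ detectably from its translate by [g]. *)
Lemma bump (g : G) : g != 1%g -> exists phi : G -> R,
  [/\ continuous phi, forall x, phi x^-1%g = phi x, phi 1%g != 0 &
      forall x, phi x * phi (g^-1 * x)%g = 0].
Proof.
move=> g1.
have [A [B [oA oB A1 Bg AB]]] : exists A B : set G,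
    [/\ open A, open B, A 1%g, B g^-1%g & A `&` B = set0].
  have := cG.2; rewrite open_hausdorff => /(_ 1%g g^-1%g)[|[A B] [/set_mem A1 /set_mem Bg]].
    by apply: contra_neq g1 => /(congr1 (fun x => x^-1%g)); rewrite invg1 invgK => <-.
  by move=> [oA oB /eqP AB]; exists A, B.
pose W := A `&` (fun x => g^-1 * x)%g @^-1` B.
have oW : open W.
  apply: openI => //; by move/continuousP: (@lmulg_continuous G g^-1%g); apply.
have W1 : W 1%g by split => //=; rewrite mulg1.
have /(uniform_separatorP (R := R))[v [cv _ v0 v1]] : uniform_separator [set 1%g] (~` W).
  apply: (@normal_completely_regular R G); last by move=> /(_ W1).
  - exact: compact_normal cG.2 cG.1.
  - exact: hausdorff_accessible cG.2.
  - exact: open_closedC.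
pose u x := 1 - v x.
have cu : continuous u by apply: contB => // x; exact: cvg_cst.
have uW x : u x != 0 -> W x.
  apply: contra_neqP => nWx; rewrite /u (_ : v x = 1) ?subrr //.
  by apply: v1; exists x.
exists (fun x => u x * u x^-1%g); split.
- apply: contM => // x; apply: (@cvg_comp _ _ _ (fun x : G => x^-1%g) u _ (nbhs x^-1%g)).
    exact: invg_continuous.
  exact: cu.
- by move=> x; rewrite invgK mulrC.
- rewrite invg1 /u (_ : v 1%g = 0) ?subr0 ?mulr1 ?oner_neq0 //.
  by apply: v0; exists 1%g.
move=> x; apply/eqP; rewrite -[_ == _]negbK; apply/negP.
rewrite !mulf_eq0 !negb_or => /andP[/andP[/uW[_ /= Bx] _] /andP[/uW[/= Ax _] _]].
by have : (A `&` B) (g^-1 * x)%g; [split | rewrite AB].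
Qed.

Theorem peter_weyl (g : G) : g != 1%g -> exists n (rho : G -> 'M[R]_n),
  [/\ forall x y, rho (x * y)%g = rho x *m rho y, forall x, rho x^-1%g = (rho x)^T,
      rho 1%g = 1%:M, forall i j, continuous (fun x => rho x i j) & rho g != 1%:M].
Proof.
move=> /bump[phi [cphi phiV phi1 phig]].
have [C sT] := convolution_smoothing cG muH cphi phiV; set T := convolution mu phi in sT.
(* An eigenfunction orthogonal to all functions fixed by g is moved by g. *)
pose Z := [set k : G -> R | continuous k /\ forall x, k (g^-1 * x)%g = k x].
have cZ k : Z k -> continuous k by case.
have TZ f : perp mu Z f -> perp mu Z (T f).
  move=> [cf fZ]; split; first exact: (smoothing_cont sT).
  move=> k [ck kg]; rewrite (smoothing_sym sT) //; apply: fZ; split.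
    exact: (smoothing_cont sT).
  move=> x; have := smoothing_lmul sT g^-1%g ck; move/(congr1 (fun h => h x)) => /= <-.
  by rewrite (_ : (fun _ => _) = k) //; apply/funext.
have cphig : continuous (fun x => phi (g^-1 * x)%g) by exact: cont_lmul.
pose f x := phi x - phi (g^-1 * x)%g.
have cf : continuous f by exact: contB.
have [|m [h [m0 oh hh Th]]] := eigenfunction cG muH sT cZ TZ.
  exists f.
    split => // k [ck kg]; rewrite ipBl //; apply/eqP; rewrite subr_eq0; apply/eqP.
    rewrite -(ip_lmul cG muH g^-1%g cphi ck); congr haar_int; apply/funext => x.
    by rewrite kg.
  rewrite lt_def ip_ge0 andbT; apply/eqP => Tf0.
  (* The value of [T f] at 1 is [ip phi phi], since [phi] times its translate vanishes; this is
     nonzero because phi 1 is. *)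
  have := ip_eq0 cG muH (smoothing_cont sT cf) Tf0 1%g.
  rewrite /T /convolution (_ : (fun y => _) = fun y => phi y * phi y).
    by move=> /(ip_eq0 cG muH cphi)/(_ 1%g) /eqP; rewrite (negbTE phi1).
  by apply/funext => y; rewrite mulg1 phiV /f mulrBr phig subr0.
have [n [rho [rhoM rhoV rho1 crho rhog]]] :=
  eigenspace_representation cG muH (smoothing_comp cG sT) m0.
exists n, rho; split => //; apply/eqP => /rhog rg.
(* If [rho g] were the identity, [h] would be fixed by [g], hence in [Z] and orthogonal to
   itself. *)
have Zh : Z h by split; [exact: oh.1|move=> x; apply: rg; split; [exact: oh.1|]].
by move: hh; rewrite (oh.2 _ Zh) ltxx.
Qed.

End Separation.

(** * Profiniteness *)

Lemma uncountable_reals (R : realType) : ~ countable [set: R].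
Proof.
move=> cR; have : countable (`[0, 1] : set R).
  exact: sub_countable (subset_card_le (@subsetT _ _)) cR.
move=> /countable_lebesgue_measure0; rewrite lebesgue_measure_itv /= lte_fin ltr01 oppr0 adde0.
by move/eqP; rewrite eqe oner_eq0.
Qed.

(** If [K] contained the whole interval, differences with the midpoint would give a neighbourhood of
    0; any x is an integer multiple of some x / n in it, so [K] would be everything. *)
Lemma rac_interval (R : realType) (K : set R) (a b : R) : rel_alg_closed K -> K != setT ->
  a < b -> exists2 c, a < c < b & ~ K c.
Proof.
move=> Kc KT ab; apply: contrapT => no; move/eqP: KT; apply; rewrite -subTset => x _.
have Kab c : a < c < b -> K c by move=> acb; apply: contrapT => nKc; apply: no; exists c.
pose d := (b - a) / 2; have d0 : 0 < d by rewrite divr_gt0 // subr_gt0.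
have Kd y : `|y| < d -> K y.
  rewrite ltr_norml => yd; rewrite -[y](addKr ((a + b) / 2)) addrC.
  by apply: racB => //; apply: Kab; move: yd d0; rewrite /d; lra.
pose n := (Num.truncn (`|x| / d)).+1.
have n0 : (0 : R) < n%:R by rewrite ltr0n.
have : K (x / n%:R).
  apply: Kd; rewrite normrM normfV (gtr0_norm n0) ltr_pdivrMr // mulrC -ltr_pdivrMr //.
  exact: truncnS_gt.
rewrite -[X in _ -> K X](divfK (lt0r_neq0 n0)) => Kxn; apply: racM => //.
elim: n {n0 Kxn} => [|n ih]; first exact: rac0.
by rewrite -natr1; apply: racD => //; exact: rac1.
Qed.

(** On [H] the conditions f x < c and f x <= c coincide; the first is open and the second closed. *)
Lemma clopen_lt (R : realType) (T : topologicalType) (H : set T) (f : T -> R) c : clopen H ->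
  continuous f -> (forall x, H x -> f x != c) -> clopen (H `&` [set x | f x < c]).
Proof.
move=> [oH cH] cf fc; split.
  by apply: openI => //; apply: (open_comp (f := f) (D := [set y | y < c])) => // x _; exact: cf.
have -> : H `&` [set x | f x < c] = H `&` [set x | f x <= c].
  apply/seteqP; split => x [Hx /= fx]; split => //=; first exact: ltW.
  by rewrite lt_neqAle fc.
by apply: closedI => //; apply: (closed_comp (f := f) (D := [set y | y <= c])) => // x _; exact: cf.
Qed.

Section Main.
Context {R : realType} {G : topologicalGroupType} (mu : probability (borelType G) R).
Hypotheses (cG : compact_group G) (muH : is_haar mu).
Hypothesis mG : forall H : set G, subgroup H -> haar_measurable mu H.

Lemma clopen_separation (g : G) : g != 1%g -> exists U, [/\ clopen U, U 1%g & ~ U g].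
Proof.
move=> /(peter_weyl cG muH)[n [rho [rhoM rhoV rho1 crho rhog]]].
have [K [Kc KS KT Kp]] := subfield_chain (@uncountable_reals R).
pose H m := [set x | forall i j, K m (rho x i j)].
have Kn m (b : bool) : K m b%:R by case: b => /=; [exact: rac1 (Kc m) | exact: rac0 (Kc m)].
(* Orthogonality makes the entries of the inverse those of the transpose, so they stay in [K m]. *)
have sgH m : subgroup (H m).
  split; first by rewrite inE => i j; rewrite rho1 mxE.
  move=> x y; rewrite !inE => Hx Hy i j; rewrite rhoM rhoV mxE.
  by apply: (rac_sum _ (Kc m)) => k _; rewrite mxE; apply: (racM (Kc m)).
have [|m oH] := @open_of_countable_cover _ _ mu cG muH H (fun=> 1%g) sgH (fun m => mG (sgH m)).
  rewrite -subTset => x _.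
  have KS' p q : (p <= q)%N -> K p `<=` K q.
    move=> /subnK <-; elim: (q - p)%N => [//|k ih]; exact: subset_trans ih (KS _).
  have /choice[p pP] (ij : 'I_n * 'I_n) : exists p, K p (rho x ij.1 ij.2).
    have : (\bigcup_p K p) (rho x ij.1 ij.2) by rewrite KT.
    by move=> [p _ Kp']; exists p.
  (* The matrix [rho x] has finitely many entries, so one member of the increasing chain contains
     them all. *)
  exists (\max_ij p ij)%N => //; exists x; last by rewrite mul1g.
  by move=> i j; apply: (KS' _ _ _ _ (pP (i, j))); exact: (leq_bigmax (i, j)).
have cH : clopen (H m) by split=> //; exact: open_subgroup_closed.
have H1 : H m 1%g by exact: subgroup1.
have [Hg|nHg] := pselect (H m g); last by exists (H m).
have [i [j ij]] : exists i j, rho g i j != rho 1%g i j.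
  apply: contrapT => no; move/eqP: rhog; apply; rewrite -rho1; apply/matrixP => i j.
  by apply: contrapT => /eqP ij; apply: no; exists i, j.
(* [f] will be a matrix entry or its opposite, according to which of the values at 1 and [g] is the
   smaller. *)
suff sep (f : G -> R) : continuous f -> (forall x c, H m x -> ~ K m c -> f x != c) ->
    f 1%g < f g -> exists U, [/\ clopen U, U 1%g & ~ U g].
  move: ij; rewrite neq_lt => /orP[lt1|lt1]; last first.
    apply: (sep (fun x => rho x i j)) => // x c Hx nKc.
    by apply: contra_notN nKc => /eqP <-.
  apply: (sep (fun x => - rho x i j)); last by rewrite ltrN2.
    by move=> x; apply: cvgN; exact: crho.
  move=> x c Hx nKc; apply: contra_notN nKc => /eqP <-; rewrite -sub0r.
  by apply: racB => //; exact: rac0.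
move=> cf fK lt1; have [c /andP[c1 cg] nKc] := rac_interval (Kc m) (Kp m) lt1.
exists (H m `&` [set x | f x < c]); split.
- by apply: clopen_lt => // x Hx; exact: fK.
- by split.
- by move=> [_ /=]; rewrite ltNge (ltW cg).
Qed.

End Main.

Theorem theorem3p5 (R : realType) (G : topologicalGroupType)
    (mu : probability (borelType G) R) :
  compact_group G ->
  is_haar mu ->
  (forall H : set G, subgroup H -> haar_measurable mu H) ->
  strongly_complete G.
Proof.
move=> cG muH mG; split.
  by apply: (profinite_of_separated cG) => g; exact: (clopen_separation cG muH mG).
by move=> H sgH; exact: (finite_index_open cG muH sgH (mG H sgH)).
Qed.
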